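(* Let $\mathcal A$ be a GQC with field of exponents $\mathbb K$, either equal to $\mathrm{an}^*$ or natural and truncation closed; let $G$ be an ordered group with $\mathbb K$-powers, $\mathcal M$ a group of monomials stable under $\mathbb K$-powers, and $\phi:\mathcal M\to G$ an ordered group embedding respecting $\mathbb K$-powers. Let $$\mathcal F=\{\mathfrak m_0a(\mathfrak m_1,\dots,\mathfrak m_\ell):\ell\in\mathbb N,\ \mathfrak m_0\in\mathcal M,\ \mathfrak m_1,\dots,\mathfrak m_\ell\in\mathcal M^{<1},\ a\in\mathcal A_\ell\},$$ an ordered field of germs at $+\infty$ with respect to the pointwise order. Then $\phi$ can be extended to a truncation closed ordered field embedding $$\phi:\mathcal F\longrightarrow\mathbb R((G)),$$ which provides a transasymptotic expansion for the germs in $\mathcal F$, by setting $$\phi\big(\mathfrak m_0a(\mathfrak m_1,\dots,\mathfrak m_\ell)\big):=\phi(\mathfrak m_0)\,\widehat a\big(\phi(\mathfrak m_1),\dots,\phi(\mathfrak m_\ell)\big).$$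
   Context: **Generalized power series.** For $X=(X_1,\dots,X_\ell)$, $\mathbb R[[X^*]]$ is the ring of formal series $F=\sum_{r\in[0,\infty)^\ell}a_rX^r$, $a_r\in\mathbb R$, with support $\{r:a_r\neq0\}$ contained in a product of $\ell$ well-ordered subsets of $[0,\infty)$. $\mathbb R[[X_1^*,\dots,X_m^*,X_{m+1},\dots,X_\ell]]$ is the subring of series with support in $[0,\infty)^m\times\mathbb N^{\ell-m}$. $F$ is convergent if $\sum|a_r|\rho^{|r|}<\infty$ for some $\rho>0$; $\mathbb R\{X^*\}$ is the ring of convergent ones. **GQC.** For $m,n\in\mathbb N$, $\mathbf r\in(0,\infty)^{m+n}$ put $\hat I_{m,n,\mathbf r}=\prod_{i\le m}[0,r_i)\times\prod_{m<i\le m+n}(-r_i,r_i)$; the first $m$ variables are called generalized, the last $n$ standard. A generalized quasianalytic class (GQC) is a collection $\mathcal A=\{\mathcal A_{m,n,\mathbf r}\}$ of $\mathbb R$-algebras of functions $\hat I_{m,n,\mathbf r}\to\mathbb R$, continuous, and $C^1$ on the interior, such that: (a) $\mathcal A$ contains the coordinate functions and is closed under restriction to smaller polydisks, adding dummy variables, permuting the generalized variables among themselves and the standard ones among themselves, setting a variable equal to $0$, and viewing standard variables as generalized by restriction to nonnegative values; every $f\in\mathcal A_{m,n,\mathbf r}$ extends to an element of $\mathcal A_{m,n,\mathbf r'}$ for some $\mathbf r'$ with $r_i'>r_i$ for all $i$. (b) If $\mathcal A_{m,n}$ is the algebra of germs at the origin of elements of $\mathcal A_{m,n,\mathbf r}$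 ($\mathbf r$ arbitrary), there are injective $\mathbb R$-algebra morphisms $\widehat{\ }:\mathcal A_{m,n}\to\mathbb R[[X_1^*,\dots,X_m^*,X_{m+1},\dots,X_{m+n}]]$ sending coordinates to the corresponding formal variables and compatible with the operations in (a). (c) The germs are closed under the following operations, and $\widehat{\ }$ commutes with them: ramifications $x_i\mapsto x_i^\gamma$ of generalized variables ($\gamma\in\mathbb A$, $\gamma>0$) and $x_i\mapsto\pm x_i^d$ of standard ones ($d\ge1$ integer); monomial division (if $\widehat f=X^\alpha G$ with $G$ a series, then $f=x^\alpha g$ for some $g\in\mathcal A_{m,n}$); substitution for a standard variable of a germ $g\in\mathcal A_{k,l}$ with $g(0)=0$; solution of implicit equations $f=0$ with $f(0)=0$ for a standard variable in which the partial derivative of $f$ at $0$ is nonzero; blow-up substitutions: for distinct generalized $x_i,x_j$, $x_i\mapsto x_ix_j$ or $x_i\mapsto x_j(\lambda+y)$ ($\lambda>0$, $y$ a new standard variable replacing $x_i$); for $y_i$ standard and $x_j$ generalized, $y_i\mapsto x_j(\lambda+y_i)$ ($\lambda\in\mathbb R$) or $(x_j,y_i)\mapsto(x_jz,\pm z)$ ($z$ a new generalized variable replacing $y_i$); for distinct standard $y_i,y_j$, $y_i\mapsto y_j(\lambda+y_i)$ ($\lambda\in\mathbb R$). (d) For $f\in\mathcal A_{m,n,\mathbf r}$ and $c\in\hat I_{m,n,\mathbf r}$, if $m'=\#\{i\le m:c_i=0\}$, the germ at $0$ of $x\mapsto f(c+x)$, after a permutation putting the coordinates $i\le m$ with $c_i=0$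 first, is (on its domain) a germ in $\mathcal A_{m',m+n-m'}$. Write $\mathcal A_m=\mathcal A_{m,0}$ and $\widehat{\mathcal A_m}$ for its image under $\widehat{\ }$. The field of exponents $\mathbb K\subseteq\mathbb R$ is the field generated by all exponents occurring in supports of series in $\bigcup_m\widehat{\mathcal A_m}$. $\mathcal A$ is classical if all these series are ordinary power series (exponents in $\mathbb N$). $\mathbb A=\mathbb N$ if $\mathcal A$ is classical and $\mathbb A=\mathbb K_{\ge0}$ otherwise. $\mathcal A$ is truncation closed if for all $f\in\mathcal A_{1+m}$ and $\alpha_0\ge0$, writing $\widehat f=\sum_\alpha c_\alpha(X_1,\dots,X_m)X_0^\alpha$, one has $\sum_{\alpha<\alpha_0}c_\alpha X_0^\alpha\in\widehat{\mathcal A_{1+m}}$. $\mathcal A$ is natural if for all $f\in\mathcal A_m$ the support of $\widehat f$ is contained in a product of $m$ subsets of $[0,\infty)$ each having finite intersection with every $(-\infty,a)$. $\mathcal A=\mathrm{an}^*$ means $\mathcal A_m=\mathbb R\{X_1^*,\dots,X_m^*\}$ for all $m$ (germs identified with their series). **Groups and germs.** An ordered group with $\mathbb K$-powers is a totally ordered abelian multiplicative group that is an ordered $\mathbb K$-vector space, scalar multiplication being written $g\mapsto g^r$; $G^{<1}=\{g\in G:g<1\}$. $\mathbb R((G))$ is the Hahn field of series $\sum_{g\in G}b_gg$ with real coefficients and reverse well-ordered support, ordered by the sign of the leading coefficient; such a series is written $\sum_{\alpha<\gamma}c_\alpha g_\alpha$, $\gamma$ an ordinal, $c_\alpha\neq0$,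 $(g_\alpha)$ strictly decreasing. For $F=\sum a_rX^r\in\widehat{\mathcal A_\ell}$ and $g_1,\dots,g_\ell\in G^{<1}$, $F(g_1,\dots,g_\ell)=\sum_g\big(\sum_{r:\prod g_i^{r_i}=g}a_r\big)g\in\mathbb R((G))$ (inner sums are finite). $\mathcal R$ is the ring of germs at $+\infty$ of real functions. In $\mathcal R$: $f\le g$ is the pointwise order near $+\infty$; $f\preceq g$ iff $\lim_{x\to+\infty}f/g\in\mathbb R$; $f\prec g$ iff $f/g\to0$; $f\sim_{+\infty}g$ iff $f/g\to1$. A group of monomials $\mathcal M$ is a multiplicative group of germs in $\mathcal R$ with values in $(0,\infty)$, totally ordered by $\preceq$ (which then agrees with $\leq$ on $\mathcal M$); $\mathcal M^{<1}=\{\mathfrak m\in\mathcal M:\mathfrak m<1\}$. Stable under $\mathbb K$-powers: $\mathfrak m^r\in\mathcal M$ for $\mathfrak m\in\mathcal M$, $r\in\mathbb K$. $\phi$ respects $\mathbb K$-powers: $\phi(\mathfrak m^r)=\phi(\mathfrak m)^r$. **Expansions.** A family $(\mathfrak m_\alpha)_{\alpha<\gamma}$ in $\mathcal M$ is a transasymptotic scale if $\mathfrak m_\beta\prec\mathfrak m_\alpha$ for $\alpha<\beta<\gamma$. An ordered field embedding $\phi:\mathcal F\to\mathbb R((G))$ mapping $\mathcal M$ into $G$ is truncation closed if for every $\sum_{\alpha<\gamma}c_\alpha g_\alpha\in\mathrm{Im}(\phi)$ and $\beta<\gamma$ there is a (unique) $f_\beta\in\mathcal F$ with $\phi(f_\beta)=\sum_{\alpha<\beta}c_\alpha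 g_\alpha$ (so $g_\alpha\in\mathrm{Im}(\phi)$). A truncation closed $\phi$ provides a transasymptotic expansion (with real coefficients and scales in $\mathcal M$) if for every $f\in\mathcal F$, writing $\phi(f)=\sum_{\alpha<\gamma}c_\alpha g_\alpha$, we have $\phi^{-1}(g_\beta)\in\mathcal M$ and $f-f_\beta\sim_{+\infty}c_\beta\,\phi^{-1}(g_\beta)$ for every $\beta<\gamma$. *)

(* Defs.v *)
From HB Require Import structures.
From mathcomp Require Import all_boot all_order all_fingroup all_algebra.
From mathcomp Require Import all_classical all_reals all_analysis.
From mathcomp Require Import wochoice generic_quotient.
Set Implicit Arguments.
Unset Strict Implicit.
Unset Printing Implicit Defensive.
Import Order.TTheory GRing.Theory Num.Theory.
Import numFieldNormedType.Exports.
Local Open Scope classical_set_scope.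
Local Open Scope ring_scope.
Local Open Scope quotient_scope.

Section Points.
Context {R : realType}.

(* v with its i-th coordinate replaced by t *)
Definition upd l (i : 'I_l) (t : R) (v : 'rV[R]_l) : 'rV[R]_l :=
  \row_k (if k == i then t else v 0 k).

(* insertion of a new coordinate t at position i; col' i is the converse *)
Definition ins l (i : 'I_l.+1) (t : R) (v : 'rV[R]_l) : 'rV[R]_l.+1 :=
  \row_k oapp (fun k' => v 0 k') t (unlift i k).

(* the point whose i-th coordinate is the p(i)-th coordinate of v *)
Definition pull l l' (p : 'I_l -> 'I_l') (v : 'rV[R]_l') : 'rV[R]_l :=
  \row_i v 0 (p i).

Definition positive_row l (r : 'rV[R]_l) : Prop := forall i, 0 < r 0 i.

(* In dimension l with m generalized variables (m <= l), the generalized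
   variables are those of index i < m and the l - m others are standard, so
   that m and n = l - m are the two arities of the polydisk. *)
Definition Ihat m l (r : 'rV[R]_l) : set 'rV[R]_l :=
  [set v | forall i : 'I_l,
     (if (i < m)%N then 0 <= v 0 i else - r 0 i < v 0 i) /\ v 0 i < r 0 i].

(* equality of germs at the origin *)
Definition origin_eq m l (f g : 'rV[R]_l -> R) : Prop :=
  exists2 r : 'rV[R]_l, positive_row r & forall v, Ihat m r v -> f v = g v.

(* x^alpha, with natural powers of the standard variables *)
Definition monomial_fun m l (alpha v : 'rV[R]_l) : R :=
  \prod_(i < l) (if (i < m)%N then v 0 i `^ alpha 0 i
                 else v 0 i ^+ Num.truncn (alpha 0 i)).

Definition C1_on l (U : set 'rV[R]_l) (f : 'rV[R]_l -> R) : Prop :=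
  forall i : 'I_l, forall v, U v ->
    derivable f v (delta_mx 0 i) /\
    {for v, continuous (fun w => 'D_(delta_mx 0 i) f w)}.

End Points.

Section Series.
Context {R : realType}.

(* A formal series in l variables is its function of coefficients. *)
Definition gseries l : Type := 'rV[R]_l -> R.

(* membership in R[[X_1^*, ..., X_m^*, X_{m+1}, ..., X_l]] *)
Definition is_gseries m l (F : gseries l) : Prop :=
  exists2 S : 'I_l -> set R,
    forall i, wo_chain <=%R [in S i] /\ (forall t, S i t -> 0 <= t) &
    forall r, F r != 0 ->
      forall i, S i (r 0 i) /\ ((m <= i)%N -> r 0 i \is a Num.nat).

Definition gmono l (e : 'rV[R]_l) : gseries l := fun s => (s == e)%:R.

(* All sums over [set: T] below have finitely many nonzero terms on series in
   the sense of is_gseries. *)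
Definition gmul l (F G : gseries l) : gseries l :=
  fun s => \sum_(r \in [set: 'rV[R]_l]) F r * G (s - r).

Definition gexp l (G : gseries l) (k : nat) : gseries l :=
  iter k (gmul G) (gmono 0).

(* Formal substitution: gsubst M F replaces each monomial X^r of F by the
   series M r. *)
Definition gsubst l l' (M : 'rV[R]_l -> gseries l') (F : gseries l) :
    gseries l' :=
  fun s => \sum_(r \in [set: 'rV[R]_l]) F r * M r s.

(* generalized binomial coefficient t(t-1)...(t-k+1)/k! *)
Definition gbinom (t : R) (k : nat) : R :=
  (\prod_(j < k) (t - j%:R)) / k`!%:R.

(* coefficient of Y^u in (lambda + Y)^t, for lambda > 0 and t >= 0 *)
Definition binom_coef (lambda t u : R) : R :=
  if u \is a Num.nat then
    gbinom t (Num.truncn u) * lambda `^ (t - u)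
  else 0.

(* coefficient of Y^u in (lambda + Y)^t, for t a natural number *)
Definition nat_binom_coef (lambda t u : R) : R :=
  if u \is a Num.nat then
    'C(Num.truncn t, Num.truncn u)%:R *
      lambda ^+ (Num.truncn t - Num.truncn u)
  else 0.

Definition gseries_convergent l (F : gseries l) : Prop :=
  is_gseries l F /\
  exists2 rho : R, 0 < rho &
    summable [set: 'rV[R]_l]
      (fun r => (F r * rho `^ (\sum_(i < l) r 0 i))%:E).

(* sum of the family F r * x^r, as the difference of the sums of its positive
   and negative parts *)
Definition gseries_sum l (F : gseries l) (v : 'rV[R]_l) : R :=
  let u := fun r => (F r * monomial_fun l r v)%:E in
  fine (\esum_(r in [set: 'rV[R]_l]) (u^\+)%E r)
  - fine (\esum_(r in [set: 'rV[R]_l]) (u^\-)%E r).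

End Series.
Arguments gseries : clear implicits.

(* fam m r is A_{m, l - m, r}; an element of it, a function on Ihat m r, is
   represented by any of its extensions to 'rV[R]_l. hat m is the morphism
   f |-> \hat f on A_{m, l - m}, defined on representatives of germs. *)
Record fun_class (R : realType) := FunClass {
  fam : forall m l : nat, 'rV[R]_l -> set ('rV[R]_l -> R);
  hat : forall m l : nat, ('rV[R]_l -> R) -> gseries R l }.
Arguments fam {R} A m {l} r : rename.
Arguments hat {R} A m {l} f : rename.

Section GQC.
Context {R : realType} (A : fun_class R).

(* the representatives of the germs of A_{m, l - m} *)
Definition germs m l : set ('rV[R]_l -> R) :=
  [set f | (m <= l)%N /\ exists2 r, positive_row r & fam A m r f].

(* exponents occurring in the series of the \hat A_m *)
Definition exponents : set R :=
  [set t | exists m (f : 'rV[R]_m -> R) (r : 'rV[R]_m) (i : 'I_m),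
     [/\ germs m f, hat A m f r != 0 & t = r 0 i]].

Definition exponent_field : set R :=
  [set t | forall S : {pred R}, GRing.divring_closed S ->
     (forall u, exponents u -> u \in S) -> t \in S].

Definition classical : Prop := forall t, exponents t -> t \is a Num.nat.

(* blackboard A: N if the class is classical, K_{>=0} otherwise *)
Definition ramifications : set R :=
  [set t | (classical /\ t \is a Num.nat) \/
           (~ classical /\ exponent_field t /\ 0 <= t)].

(* A_{m, l - m} is closed under composition with sigma (with result in
   A_{m', l' - m'}), which \hat turns into the formal substitution of M r
   for X^r. *)
Definition closed_under_subst m m' l l'
    (sigma : 'rV[R]_l' -> 'rV[R]_l) (M : 'rV[R]_l -> gseries R l') : Prop :=
  forall f, germs m f ->
    germs m' (f \o sigma) /\ hat A m' (f \o sigma) = gsubst M (hat A m f).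

Record is_GQC_algebras : Prop := {
  (* independence of the chosen extension to 'rV[R]_l *)
  fam_ext : forall m l (r : 'rV[R]_l) f g, (m <= l)%N -> positive_row r ->
    fam A m r f -> (forall v, Ihat m r v -> f v = g v) -> fam A m r g;
  fam_cst : forall m l (r : 'rV[R]_l) (c : R), (m <= l)%N -> positive_row r ->
    fam A m r (fun=> c);
  fam_add : forall m l (r : 'rV[R]_l) f g, (m <= l)%N -> positive_row r ->
    fam A m r f -> fam A m r g -> fam A m r (fun v => f v + g v);
  fam_mul : forall m l (r : 'rV[R]_l) f g, (m <= l)%N -> positive_row r ->
    fam A m r f -> fam A m r g -> fam A m r (fun v => f v * g v);
  fam_continuous : forall m l (r : 'rV[R]_l) f, (m <= l)%N ->
    positive_row r -> fam A m r f -> {within Ihat m r, continuous f};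
  fam_C1 : forall m l (r : 'rV[R]_l) f, (m <= l)%N -> positive_row r ->
    fam A m r f -> C1_on (interior (Ihat m r)) f }.

Record is_GQC_operations : Prop := {
  fam_coord : forall m l (r : 'rV[R]_l) (i : 'I_l), (m <= l)%N ->
    positive_row r -> fam A m r (fun v => v 0 i);
  fam_restrict : forall m l (r r' : 'rV[R]_l) f, (m <= l)%N ->
    positive_row r -> positive_row r' -> (forall i, r' 0 i <= r 0 i) ->
    fam A m r f -> fam A m r' f;
  (* Adding dummy variables, permuting the generalized (standard) variables
     and viewing standard variables as generalized are all given by injections
     p of the variables of f into the new variables which send generalized
     variables to generalized variables. *)
  fam_rename : forall m l m' l' (p : 'I_l -> 'I_l') (r : 'rV[R]_l') f,
    (m <= l)%N -> (m' <= l')%N -> injective p ->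
    (forall i : 'I_l, (i < m)%N -> (p i < m')%N) -> positive_row r ->
    fam A m (pull p r) f -> fam A m' r (f \o pull p);
  fam_zero : forall m l (i : 'I_l.+1) (r : 'rV[R]_l.+1) f, (m <= l.+1)%N ->
    positive_row r -> fam A m r f ->
    fam A (m - (i < m)%N)%N (col' i r) (f \o ins i 0);
  fam_extend : forall m l (r : 'rV[R]_l) f, (m <= l)%N -> positive_row r ->
    fam A m r f ->
    exists (r' : 'rV[R]_l) (g : 'rV[R]_l -> R),
      [/\ forall i, r 0 i < r' 0 i, fam A m r' g &
          forall v, Ihat m r v -> g v = f v] }.

(* compatibility of \hat with restrictions is hat_germ *)
Record is_GQC_morphism : Prop := {
  hat_gseries : forall m l (f : 'rV[R]_l -> R), germs m f ->
    is_gseries m (hat A m f);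
  hat_germ : forall m l (f g : 'rV[R]_l -> R), germs m f -> germs m g ->
    origin_eq m f g -> hat A m f = hat A m g;
  hat_inj : forall m l (f g : 'rV[R]_l -> R), germs m f -> germs m g ->
    hat A m f = hat A m g -> origin_eq m f g;
  hat_cst : forall m l (c : R), (m <= l)%N ->
    hat A m (fun _ : 'rV[R]_l => c) = (fun s => c * gmono 0 s);
  hat_add : forall m l (f g : 'rV[R]_l -> R), germs m f -> germs m g ->
    hat A m (fun v => f v + g v) = (fun s => hat A m f s + hat A m g s);
  hat_mul : forall m l (f g : 'rV[R]_l -> R), germs m f -> germs m g ->
    hat A m (fun v => f v * g v) = gmul (hat A m f) (hat A m g);
  hat_coord : forall m l (i : 'I_l), (m <= l)%N ->
    hat A m (fun v : 'rV[R]_l => v 0 i) = gmono (delta_mx 0 i);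
  hat_rename : forall m l m' l' (p : 'I_l -> 'I_l') f,
    (m' <= l')%N -> injective p ->
    (forall i : 'I_l, (i < m)%N -> (p i < m')%N) -> germs m f ->
    hat A m' (f \o pull p) =
      gsubst (fun r => gmono (\row_j \sum_(i | p i == j) r 0 i)) (hat A m f);
  hat_zero : forall m l (i : 'I_l.+1) (f : 'rV[R]_l.+1 -> R), germs m f ->
    hat A (m - (i < m)%N)%N (f \o ins i 0) =
      gsubst (fun r s => if r 0 i == 0 then gmono (col' i r) s else 0)
             (hat A m f) }.

Record is_GQC_closed : Prop := {
  (* x_i |-> x_i^gamma *)
  closed_ramif : forall m l (i : 'I_l) (gamma : R), (i < m)%N ->
    ramifications gamma -> 0 < gamma ->
    closed_under_subst m m
      (fun v => upd i (v 0 i `^ gamma) v)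
      (fun r => gmono (upd i (gamma * r 0 i) r));
  (* x_i |-> (-1)^b x_i^d *)
  closed_ramif_std : forall m l (i : 'I_l) (b : bool) (d : nat), (m <= i)%N ->
    (0 < d)%N ->
    closed_under_subst m m
      (fun v => upd i ((-1) ^+ b * v 0 i ^+ d) v)
      (fun r s => ((-1) ^+ b) ^+ Num.truncn (r 0 i)
                  * gmono (upd i (d%:R * r 0 i) r) s);
  (* For an arbitrary real alpha, X = X^alpha X^(1 - alpha) would make every
     real an exponent of the class. *)
  closed_monomial_div : forall m l (f : 'rV[R]_l -> R) (alpha : 'rV[R]_l)
      (G : gseries R l),
    germs m f ->
    (forall i : 'I_l, if (i < m)%N then ramifications (alpha 0 i)
                      else alpha 0 i \is a Num.nat) ->
    is_gseries m G -> hat A m f = gmul (gmono alpha) G ->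
    exists g, [/\ germs m g,
      origin_eq m f (fun v => monomial_fun m alpha v * g v) &
      hat A m g = G];
  (* x_i |-> g(x), where g is a germ in the other variables *)
  closed_compose : forall m l (i : 'I_l.+1) (g : 'rV[R]_l -> R), (m <= i)%N ->
    germs m g -> g 0 = 0 ->
    closed_under_subst m m
      (fun v => ins i (g v) v)
      (fun r => gmul (gmono (col' i r))
                     (gexp (hat A m g) (Num.truncn (r 0 i))));
  closed_implicit : forall m l (i : 'I_l.+1) (f : 'rV[R]_l.+1 -> R),
    (m <= i)%N -> germs m f -> f 0 = 0 -> 'D_(delta_mx 0 i) f 0 != 0 ->
    exists g : 'rV[R]_l -> R,
      [/\ germs m g, g 0 = 0,
          origin_eq m (fun v => f (ins i (g v) v)) (fun=> 0) &
          gsubst (fun r => gmul (gmono (col' i r))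
                                (gexp (hat A m g) (Num.truncn (r 0 i))))
                 (hat A m f) = (fun=> 0)];
  (* x_i |-> x_i x_j, both generalized *)
  closed_blowup_gen : forall m l (i j : 'I_l), (i < m)%N -> (j < m)%N ->
    i != j ->
    closed_under_subst m m
      (fun v => upd i (v 0 i * v 0 j) v)
      (fun r => gmono (r + r 0 i *: delta_mx 0 j));
  (* x_i |-> x_j (lambda + y), both generalized; the new standard variable y
     is at position q and col' q w is the row of the other variables *)
  closed_blowup_gen_std : forall m l (i q : 'I_l.+1) (j : 'I_l) (lambda : R),
    (i < m.+1)%N -> (m <= q)%N -> (j < m)%N -> 0 < lambda ->
    closed_under_subst m.+1 m
      (fun w => let v := col' q w in ins i (v 0 j * (lambda + w 0 q)) v)
      (fun r s => if col' q s == col' i r + r 0 i *: delta_mx 0 j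
                  then binom_coef lambda (r 0 i) (s 0 q) else 0);
  (* x_i |-> x_j (lambda + x_i) with x_i standard, x_j of either kind *)
  closed_blowup_std : forall m l (i j : 'I_l) (lambda : R), (m <= i)%N ->
    i != j ->
    closed_under_subst m m
      (fun v => upd i (v 0 j * (lambda + v 0 i)) v)
      (fun r s => if upd i 0 s == upd i 0 r + r 0 i *: delta_mx 0 j
                  then nat_binom_coef lambda (r 0 i) (s 0 i) else 0);
  (* (x_j, y_i) |-> (x_j z, (-1)^b z), x_j generalized, y_i standard; the new
     generalized variable z is at position q *)
  closed_blowup_std_gen : forall m l (i q : 'I_l.+1) (j : 'I_l) (b : bool),
    (m <= i)%N -> (q < m.+1)%N -> (j < m)%N ->
    closed_under_subst m m.+1
      (fun w => let v := col' q w in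
         ins i ((-1) ^+ b * w 0 q) (upd j (v 0 j * w 0 q) v))
      (fun r s => let e := col' i r in
         ((-1) ^+ b) ^+ Num.truncn (r 0 i)
         * gmono (ins q (r 0 i + e 0 j) e) s) }.

Definition is_GQC_translation : Prop :=
  forall m l (r c : 'rV[R]_l) f, (m <= l)%N -> positive_row r ->
    fam A m r f -> Ihat m r c ->
    let m' := #|[pred i : 'I_l | (i < m)%N && (c 0 i == 0)]| in
    forall p : {perm 'I_l},
      (forall i, (p i < m')%N = (i < m)%N && (c 0 i == 0)) ->
      germs m' (fun v => f (c + pull p v)).

Record is_GQC : Prop := {
  GQC_algebras : is_GQC_algebras;
  GQC_operations : is_GQC_operations;
  GQC_morphism : is_GQC_morphism;
  GQC_closed : is_GQC_closed;
  GQC_translation : is_GQC_translation }.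

Definition truncation_closed_class : Prop :=
  forall m (f : 'rV[R]_m.+1 -> R) (alpha0 : R), germs m.+1 f -> 0 <= alpha0 ->
    exists2 g, germs m.+1 g &
      hat A m.+1 g = (fun s => if s 0 ord0 < alpha0 then hat A m.+1 f s else 0).

Definition natural_class : Prop :=
  forall m (f : 'rV[R]_m -> R), germs m f ->
    exists2 S : 'I_m -> set R,
      forall i, (forall t, S i t -> 0 <= t) /\
                (forall a, finite_set (S i `&` [set t | t < a])) &
      forall r, hat A m f r != 0 -> forall i, S i (r 0 i).

(* A_m = R{X_1^*, ..., X_m^*}, germs being identified with their series *)
Definition is_an_star : Prop :=
  forall m (f : 'rV[R]_m -> R) (F : gseries R m),
    (germs m f /\ hat A m f = F) <->
    (gseries_convergent F /\ origin_eq m f (gseries_sum F)).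

End GQC.

Record ordered_group_with_powers (R : realType) (K : set R) (G : groupType)
    (le : rel G) (pow : G -> R -> G) : Prop := {
  og_mulC : forall g h : G, (g * h = h * g)%g;
  og_order : total_order le;
  og_le_mul : forall g h k : G, le g h -> le (g * k)%g (h * k)%g;
  og_pow1 : forall g, pow g 1 = g;
  og_powD : forall g r s, K r -> K s -> pow g (r + s) = (pow g r * pow g s)%g;
  og_powM : forall g r s, K r -> K s -> pow g (r * s) = pow (pow g r) s;
  og_mul_pow : forall g h r, K r -> pow (g * h)%g r = (pow g r * pow h r)%g;
  og_pow_ge1 : forall g r, K r -> 0 <= r -> le 1%g g -> le 1%g (pow g r) }.

Section Hahn.
Context {R : realType} {G : groupType} (le : rel G).

Definition lt_of (g h : G) : bool := (g != h) && le g h.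

(* F : G -> R is a series of R((G)) *)
Definition is_hahn (F : G -> R) : Prop :=
  wo_chain (fun g h => le h g) [pred g | F g != 0].

Definition hahn_mono (g : G) : G -> R := fun h => (h == g)%:R.

Definition hahn_add (E F : G -> R) : G -> R := fun g => E g + F g.

Definition hahn_mul (E F : G -> R) : G -> R :=
  fun g => \sum_(h \in [set: G]) E h * F (h^-1 * g)%g.

(* F has a positive leading coefficient *)
Definition hahn_pos (F : G -> R) : Prop :=
  exists2 g, 0 < F g & forall h, lt_of g h -> F h = 0.

Definition hahn_le (E F : G -> R) : Prop :=
  E = F \/ hahn_pos (fun g => F g - E g).

(* If F = \sum_(alpha < gamma) c_alpha g_alpha, the indices beta < gamma are in
   bijection with the support of F via beta |-> g_beta, and for g = g_beta this
   is \sum_(alpha < beta) c_alpha g_alpha. *)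
Definition hahn_trunc (g : G) (F : G -> R) : G -> R :=
  fun h => if lt_of g h then F h else 0.

(* F(g_1, ..., g_l) *)
Definition hahn_eval (pow : G -> R -> G) l (F : gseries R l) (g : 'I_l -> G) :
    G -> R :=
  fun h => \sum_(r \in [set r : 'rV[R]_l |
                          (\prod_(i < l) pow (g i) (r 0 i))%g = h]) F r.

End Hahn.

Section Germ.
Context {R : realType}.

Definition germ_eqb : rel (R -> R) :=
  fun f g => `[< \forall x \near +oo, f x = g x >].

Lemma germ_eqb_refl : reflexive germ_eqb.
Proof. by move=> f; apply/asboolP; near=> x. Unshelve. all: by end_near. Qed.

Lemma germ_eqb_sym : symmetric germ_eqb.
Proof.
by move=> f g; apply/asboolP/asboolP; apply: filterS => x ->.
Qed.

Lemma germ_eqb_trans : transitive germ_eqb.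
Proof.
move=> g f h /asboolP fg /asboolP gh; apply/asboolP.
by apply: filterS2 fg gh => x -> ->.
Qed.

Canonical germ_equiv :=
  EquivRel germ_eqb germ_eqb_refl germ_eqb_sym germ_eqb_trans.

Definition germ := {eq_quot germ_equiv}.

HB.instance Definition _ := Choice.on germ.
HB.instance Definition _ := Quotient.on germ.

Definition germ_of (f : R -> R) : germ := \pi_germ f.

Lemma germ_ofP (f g : R -> R) :
  germ_of f = germ_of g <-> \forall x \near +oo, f x = g x.
Proof.
split=> [/eqquotP/asboolP//|fg]; exact/eqquotP/asboolP.
Qed.

Lemma repr_germ_of (f : R -> R) : \forall x \near +oo, repr (germ_of f) x = f x.
Proof. by apply/germ_ofP; rewrite /germ_of reprK. Qed.

Definition germ_add (a b : germ) := germ_of (fun x => repr a x + repr b x).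
Definition germ_opp (a : germ) := germ_of (fun x => - repr a x).
Definition germ_mul (a b : germ) := germ_of (fun x => repr a x * repr b x).

Lemma germ_ext (a b : germ) : (\forall x \near +oo, repr a x = repr b x) ->
  a = b.
Proof. by move=> /germ_ofP; rewrite /germ_of !reprK. Qed.

Lemma germ_addA : associative germ_add.
Proof.
move=> a b c; apply/germ_ofP; near=> x.
have -> : repr (germ_add b c) x = repr b x + repr c x.
  by near: x; exact: repr_germ_of.
have -> : repr (germ_add a b) x = repr a x + repr b x.
  by near: x; exact: repr_germ_of.
exact: addrA.
Unshelve. all: by end_near. Qed.

Lemma germ_addC : commutative germ_add.
Proof. by move=> a b; congr germ_of; apply/funext => x; exact: addrC. Qed.

Lemma germ_add0 : left_id (germ_of (fun=> 0)) germ_add.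
Proof.
move=> a; apply/germ_ext; near=> x.
have -> : repr (germ_add (germ_of (fun=> 0)) a) x =
          repr (germ_of (fun=> 0)) x + repr a x.
  by near: x; exact: repr_germ_of.
have -> : repr (germ_of (fun=> 0)) x = 0 by near: x; exact: repr_germ_of.
exact: add0r.
Unshelve. all: by end_near. Qed.

Lemma germ_addN : left_inverse (germ_of (fun=> 0)) germ_opp germ_add.
Proof.
move=> a; apply/germ_ofP; near=> x.
have -> : repr (germ_opp a) x = - repr a x by near: x; exact: repr_germ_of.
exact: addNr.
Unshelve. all: by end_near. Qed.

HB.instance Definition _ :=
  GRing.isZmodule.Build germ germ_addA germ_addC germ_add0 germ_addN.

Lemma germ_mulA : associative germ_mul.
Proof.
move=> a b c; apply/germ_ofP; near=> x.
have -> : repr (germ_mul b c) x = repr b x * repr c x.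
  by near: x; exact: repr_germ_of.
have -> : repr (germ_mul a b) x = repr a x * repr b x.
  by near: x; exact: repr_germ_of.
exact: mulrA.
Unshelve. all: by end_near. Qed.

Lemma germ_mulC : commutative germ_mul.
Proof. by move=> a b; congr germ_of; apply/funext => x; exact: mulrC. Qed.

Lemma germ_mul1 : left_id (germ_of (fun=> 1)) germ_mul.
Proof.
move=> a; apply/germ_ext; near=> x.
have -> : repr (germ_mul (germ_of (fun=> 1)) a) x =
          repr (germ_of (fun=> 1)) x * repr a x.
  by near: x; exact: repr_germ_of.
have -> : repr (germ_of (fun=> 1)) x = 1 by near: x; exact: repr_germ_of.
exact: mul1r.
Unshelve. all: by end_near. Qed.

Lemma germ_mulDl : left_distributive germ_mul germ_add.
Proof.
move=> a b c; apply/germ_ofP; near=> x.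
have -> : repr (germ_add a b) x = repr a x + repr b x.
  by near: x; exact: repr_germ_of.
have -> : repr (germ_mul a c) x = repr a x * repr c x.
  by near: x; exact: repr_germ_of.
have -> : repr (germ_mul b c) x = repr b x * repr c x.
  by near: x; exact: repr_germ_of.
exact: mulrDl.
Unshelve. all: by end_near. Qed.

Lemma germ_1neq0 : germ_of (fun=> 1) != germ_of (fun=> 0).
Proof.
apply/eqP => /germ_ofP /filter_ex[x /eqP]; by rewrite oner_eq0.
Qed.

HB.instance Definition _ := GRing.Zmodule_isComNzRing.Build germ
  germ_mulA germ_mulC germ_mul1 germ_mulDl germ_1neq0.

Definition germ_le (a b : germ) : Prop :=
  \forall x \near +oo, repr a x <= repr b x.

Definition germ_lt (a b : germ) : Prop := a <> b /\ germ_le a b.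

Definition germ_preceq (a b : germ) : Prop :=
  exists c : R, repr a x / repr b x @[x --> +oo] --> c.

Definition germ_sim (a b : germ) : Prop :=
  repr a x / repr b x @[x --> +oo] --> (1 : R).

Definition germ_cst (c : R) : germ := germ_of (fun=> c).

Definition germ_pow (a : germ) (r : R) : germ := germ_of (fun x => repr a x `^ r).

(* a(m_1, ..., m_l) *)
Definition germ_comp l (a : 'rV[R]_l -> R) (m : 'I_l -> germ) : germ :=
  germ_of (fun x => a (\row_i repr (m i) x)).

Record monomial_group (M : set germ) : Prop := {
  mg_pos : forall m, M m -> \forall x \near +oo, 0 < repr m x;
  mg_one : M 1;
  mg_mul : forall m n, M m -> M n -> M (m * n);
  mg_inv : forall m, M m -> exists2 n, M n & m * n = 1;
  mg_total : forall m n, M m -> M n -> germ_preceq m n \/ germ_preceq n m;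
  mg_anti : forall m n, M m -> M n -> germ_preceq m n -> germ_preceq n m ->
    m = n }.

Record is_ordered_field (F : set germ) : Prop := {
  of_one : F 1;
  of_sub : forall f g, F f -> F g -> F (f - g);
  of_mul : forall f g, F f -> F g -> F (f * g);
  of_inv : forall f, F f -> f != 0 -> exists2 g, F g & f * g = 1;
  of_total : forall f g, F f -> F g -> germ_le f g \/ germ_le g f }.

Definition class_germs (A : fun_class R) (M : set germ) : set germ :=
  [set f | exists l (m0 : germ) (m : 'I_l -> germ) (a : 'rV[R]_l -> R),
     [/\ M m0, forall i, M (m i) /\ germ_lt (m i) 1, germs A l a &
         f = m0 * germ_comp a m]].

End Germ.
Arguments germ : clear implicits.

Section Embeddings.
Context {R : realType} {G : groupType} (le : rel G).

Record ordered_group_embedding (M : set (germ R)) (phi : germ R -> G) :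
    Prop := {
  oge_mul : forall m n, M m -> M n -> phi (m * n) = (phi m * phi n)%g;
  oge_le : forall m n, M m -> M n -> le (phi m) (phi n) <-> germ_le m n }.

Variables (F M : set (germ R)) (Phi : germ R -> G -> R).

Record ordered_field_embedding : Prop := {
  ofe_hahn : forall f, F f -> is_hahn le (Phi f);
  ofe_one : Phi 1 = hahn_mono 1%g;
  ofe_add : forall f g, F f -> F g -> Phi (f + g) = hahn_add (Phi f) (Phi g);
  ofe_mul : forall f g, F f -> F g -> Phi (f * g) = hahn_mul (Phi f) (Phi g);
  ofe_le : forall f g, F f -> F g ->
    hahn_le le (Phi f) (Phi g) <-> germ_le f g }.

Definition truncation_closed : Prop :=
  forall f g, F f -> Phi f g != 0 ->
    exists fg, F fg /\ Phi fg = hahn_trunc le g (Phi f).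

Definition transasymptotic : Prop :=
  forall f g, F f -> Phi f g != 0 ->
    exists m, [/\ M m, Phi m = hahn_mono g &
      forall fg, F fg -> Phi fg = hahn_trunc le g (Phi f) ->
        germ_sim (f - fg) (germ_cst (Phi f g) * m)].

End Embeddings.

(* Main.v *)
(* Let m_1, ..., m_l be small monomials and a a germ of A_l with series F. By
   Dickson's lemma the support of F has finitely many minimal elements. Given
   two of them, r and s, and coordinates with r_i > s_i and r_j < s_j,
   ramifications make these differences opposite. If then m_i = m_j, one
   variable can be eliminated; otherwise, say m_i = q m_j with q < 1, and the
   blow-up x_i |-> x_i x_j makes r and s agree in one more coordinate. After
   finitely many steps the minimal elements are pairwise comparable, so that
   a = x^e g with g(0) = c <> 0. Hence a(m) is equivalent to c N for a monomial
   N, and c phi(N) is the leading term of F(phi(m)). As sums and products of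
   germs are computed on series, it follows that the expansion is well defined,
   injective and increasing, and that each difference f - f_beta is equivalent
   to its leading term.

   Truncations: a subseries of a convergent series converges, which settles
   the case of an^*. In the natural case, if g is the cutting point and
   phi(m_b)^alpha <= g, then only the exponents r with r_b < alpha matter;
   r_b takes finitely many such values, each of them contributes a power of x_b
   times a germ in one variable less, and one concludes by induction on l. *)

Require Import Defs.
From mathcomp Require Import all_boot all_order all_fingroup all_algebra.
From mathcomp Require Import all_classical all_reals all_analysis.
From mathcomp Require Import wochoice generic_quotient finmap lra.
Set Implicit Arguments.
Unset Strict Implicit.
Unset Printing Implicit Defensive.
Import Order.TTheory GRing.Theory Num.Theory.
Import numFieldNormedType.Exports.
Local Open Scope classical_set_scope.
Local Open Scope ring_scope.

(** * Finite bases of families of well-ordered exponents *)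

(** Two obstacles shape the proof. An element of the class has many presentations, so nothing
    guarantees in advance that its expansion is well defined: the expansion is first a relation
    [expands], stable under the field operations, and it becomes a function once 0 is known to
    expand to 0 only. To this end each change of variables acts on a germ and on its evaluated
    series simultaneously, so that one constant c = g(0) is both the limit of the germ divided by N
    and the leading coefficient of the series. Moreover, a sum over an infinite support takes the
    default value 0, so every regrouping of coefficients needs finite fibers. All operations on
    series are therefore written as pushforwards along maps of exponents, and the finiteness of the
    fibers comes from the same finite basis lemma as the minimal exponents: two comparable exponents
    of equal weight coincide, hence a fiber is contained in its own finite basis. Weights are
    additive only on exponents in the field of exponents, which is why membership in it accompanies
    each row of exponents. *)

Lemma seq_max (T : eqType) (Y : Type) (le : rel Y) (f : T -> Y) (s : seq T) x :
  reflexive le -> transitive le ->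
  {in s &, forall y z, le (f y) (f z) || le (f z) (f y)} -> x \in s ->
  exists2 y, y \in s & {in s, forall z, le (f z) (f y)}.
Proof.
move=> rle trle; elim: s x => // x s IHs _ tle _.
case: s IHs tle => [_ _|y s IHs tle].
  by exists x; rewrite ?inE// => z; rewrite inE => /eqP ->; exact: rle.
have [||z zs zmax] := IHs y; last 1 first.
- have /orP[lexz|lezx] := tle x z (mem_head _ _) (mem_behead (zs : z \in behead (x :: _))).
    exists z => [|t]; rewrite inE ?zs ?orbT// => /predU1P[->//|]; exact: zmax.
  exists x => [|t]; rewrite inE ?eqxx// => /predU1P[->|/zmax le_tz].
    exact: rle.
  exact: trle le_tz lezx.
- by move=> u v us vs; apply: tle; rewrite inE ?us ?vs orbT.
- exact: mem_head.
Qed.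

Section FiniteBasis.
Context {R : realType}.

Lemma wo_min (S C : set R) : wo_chain <=%R [in S] -> C `<=` S -> C !=set0 ->
  exists2 x, C x & forall y, C y -> x <= y.
Proof.
move=> woS CS [x Cx].
have [||z [[/set_mem Cz lb] _]] := woS [in C].
- by move=> y /set_mem /CS /mem_set.
- by exists x; exact: mem_set.
by exists z => // y Cy; apply: lb; exact: mem_set.
Qed.

(* Dickson's lemma: elements whose last coordinate is large enough are handled
   by induction on the number of coordinates, the others by well-founded
   induction on the value of this coordinate. *)
Lemma finite_basis_seq (X I : eqType) (c : X -> I -> R)
    (S : I -> set R) (s : seq I) (P : set X) :
  (forall i, wo_chain <=%R [in S i]) ->
  (forall x, P x -> forall i, S i (c x i)) ->
  exists T : seq X, (forall t, t \in T -> P t) /\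
    forall x, P x -> exists2 t, t \in T & forall i, i \in s -> c t i <= c x i.
Proof.
move=> woS; elim: s P => [|k s IHs] P PS.
  have [[x Px]|P0] := pselect (P !=set0).
    exists [:: x]; split=> [t|y _]; first by rewrite inE => /eqP ->.
    by exists x; rewrite ?inE.
  by exists [::]; split=> // x Px; case: P0; exists x.
pose basis (Q : set X) := exists T : seq X, (forall t, t \in T -> Q t) /\
  forall x, Q x -> exists2 t, t \in T &
    forall i, i \in k :: s -> c t i <= c x i.
pose below w := [set x | P x /\ c x k < w].
have step (Q : set X) : Q `<=` P ->
    (forall y, Q y -> below (c y k) `<=` Q /\ basis (below (c y k))) ->
    basis Q.
  move=> QP IH.
  have [T0 [T0Q T0b]] := IHs Q (fun x Qx => PS x (QP x Qx)).
  have [[t0 t0T]|noT0] := pselect (exists t, t \in T0); last first.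
    by exists [::]; split=> // x /T0b[t tT0]; case: noT0; exists t.
  have tot : {in T0 &, forall y z, (c y k <= c z k) || (c z k <= c y k)}.
    by move=> y z _ _; exact: le_total.
  have [t1 t1T t1max] := seq_max lexx le_trans tot t0T.
  (* The threshold is the [k]-th coordinate of [t1], the largest one in [T0]: above it every element
     of [T0] is harmless in coordinate [k], so a basis for the coordinates in [s] suffices; [T1]
     takes care of the elements below it. *)
  have [t1Q [T1 [T1Q T1b]]] := IH t1 (T0Q _ t1T).
  exists (T0 ++ T1); split=> [t|x Qx].
    by rewrite mem_cat => /orP[/T0Q//|/T1Q/t1Q].
  have [le_tx|lt_xt] := leP (c t1 k) (c x k).
    have [t tT0 tx] := T0b x Qx.
    exists t; first by rewrite mem_cat tT0.
    move=> i; rewrite inE => /predU1P[->|/tx//].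
    exact: le_trans (t1max _ tT0) le_tx.
  have [t tT1 tx] := T1b x (conj (QP _ Qx) lt_xt).
  by exists t => //; rewrite mem_cat tT1 orbT.
have basis_below w : S k w -> basis (below w).
  move=> Sw; apply: contrapT => nbw.
  pose C := [set v | S k v /\ ~ basis (below v)].
  have [||v [Sv nbv] vmin] := @wo_min (S k) C (woS k).
  - by move=> v [].
  - by exists w.
  apply: nbv; apply: step => [x []//|y [Py lt_yv]]; split.
    by move=> x [Px lt_xy]; split=> //; exact: lt_trans lt_xy lt_yv.
  apply: contrapT => nby; have := vmin (c y k) (conj (PS _ Py k) nby).
  by rewrite leNgt lt_yv.
apply: step => // y Py; split=> [x []//|]; exact/basis_below/PS.
Qed.

Lemma finite_basis (X : eqType) (I : finType) (c : X -> I -> R)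
    (S : I -> set R) (P : set X) :
  (forall i, wo_chain <=%R [in S i]) ->
  (forall x, P x -> forall i, S i (c x i)) ->
  exists T : seq X, (forall t, t \in T -> P t) /\
    forall x, P x -> exists2 t, t \in T & forall i, c t i <= c x i.
Proof.
move=> woS PS; have [T [TP Tb]] := finite_basis_seq (enum I) woS PS.
exists T; split=> // x /Tb[t tT tx]; exists t => // i.
by apply: tx; rewrite mem_enum.
Qed.

Section Weight.
Context {G : Type} (le : rel G) {X : choiceType} {I : finType}.
Variables (c : X -> I -> R) (S : I -> set R) (P : set X) (W : X -> G).
Hypothesis woS : forall i, wo_chain <=%R [in S i].
Hypothesis PS : forall x, P x -> forall i, S i (c x i).
Hypothesis W_le : forall x y, P x -> P y -> (forall i, c x i <= c y i) ->
  le (W y) (W x).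
Hypothesis W_inj : forall x y, P x -> P y -> (forall i, c x i <= c y i) ->
  W x = W y -> x = y.

(** By [W_inj], an element of the fiber equals any basis element below it, so the fiber is contained
    in its finite basis. *)
Lemma finite_weight_fiber h : finite_set [set x | P x /\ W x = h].
Proof.
have [|T [TQ Tb]] := @finite_basis X I c S [set x | P x /\ W x = h] woS.
  by move=> x [/PS].
apply: (sub_finite_set _ (finite_seq T)) => x [Px Wx].
have [t tT tx] := Tb x (conj Px Wx); have [Pt Wt] := TQ t tT.
by rewrite /= -(W_inj Pt Px tx)// Wt.
Qed.

Hypotheses (le_refl : reflexive le) (le_tr : transitive le) (le_tot : total le).
Hypothesis le_anti : antisymmetric le.

(** Since [W] is decreasing, the greatest weight over a finite basis of the preimage of [B] is the
    greatest element of [B]. *)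
Lemma wo_weight_image (D : {pred G}) :
  {subset D <= [pred g | `[< exists2 x, P x & W x = g >]]} ->
  wo_chain (fun g h => le h g) D.
Proof.
move=> DP; apply: antisymmetric_wo_chain.
  by move=> x y _ _ /andP[xy yx]; apply: le_anti; rewrite xy yx.
move=> B BD [h Bh].
have [|T [TQ Tb]] := @finite_basis X I c S [set x | P x /\ W x \in B] woS.
  by move=> x [/PS].
have BP g : g \in B -> exists2 x, P x /\ W x \in B & W x = g.
  move=> Bg; have /asboolP[x Px Wx] := DP g (BD g Bg).
  by exists x => //; rewrite Wx.
have [x0 /Tb[t0 t0T _] _] := BP h Bh.
have tot : {in T &, forall y z, le (W y) (W z) || le (W z) (W y)}.
  by move=> y z _ _; exact: le_tot.
have [t tT tmax] := seq_max le_refl le_tr tot t0T.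
exists (W t); split; first by have [] := TQ t tT.
move=> g /BP[x [Px Wx] <-]; have [u uT ux] := Tb x (conj Px Wx).
by apply: le_tr (tmax _ uT); apply: W_le => //; have [] := TQ u uT.
Qed.

End Weight.

End FiniteBasis.

(** * Sums along finite fibers *)

Section Pushforward.
Context {R : realType}.

Lemma fsum_seq (X : choiceType) (s : seq X) (D : set X) (u : X -> R) :
  uniq s -> (forall x, D x -> u x != 0 -> x \in s) ->
  \sum_(x \in D) u x = \sum_(x <- s | x \in D) u x.
Proof.
move=> us Ds; rewrite fsbig_mkcond (fsbigTE [fset x | x in s]%fset).
  rewrite -big_mkcond; apply: perm_big.
  by rewrite uniq_perm ?fset_uniq// => x; rewrite !inE.
move=> x; rewrite !inE /= /patch => xs; case: ifPn => // /set_mem Dx.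
by apply: contraNeq xs; exact: Ds.
Qed.

(* Pushforward of the coefficients u along w; the fibers of w meet the support
   of u in finite sets whenever it is used. *)
Definition push (X : choiceType) (Y : Type) (w : X -> Y) (u : X -> R) : Y -> R :=
  fun y => \sum_(x \in [set x | w x = y]) u x.

Definition tensor (X Y : Type) (u : X -> R) (v : Y -> R) : X * Y -> R :=
  fun p => u p.1 * v p.2.

Lemma push_neq0 (X : choiceType) (Y : Type) (w : X -> Y) (u : X -> R) y :
  push w u y != 0 -> exists2 x, u x != 0 & w x = y.
Proof.
move=> /eqP; apply: contra_notP => nx; apply: fsbig1 => x wx.
by apply: contra_notP nx => /eqP ux; exists x.
Qed.

Lemma eq_push (X : choiceType) (Y : Type) (w w' : X -> Y) (u : X -> R) :
  (forall x, u x != 0 -> w x = w' x) -> push w u = push w' u.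
Proof.
move=> ww'; apply/funext => y; rewrite /push [LHS]fsbig_supp [RHS]fsbig_supp.
apply: eq_fsbigl; apply/seteqP; split=> x [/= <- /eqP ux].
  by split; [rewrite -ww'|exact/eqP].
by split; [rewrite ww'|exact/eqP].
Qed.

Lemma push_unique (X : choiceType) (Y : Type) (w : X -> Y) (u : X -> R) x :
  (forall x', u x' != 0 -> w x' = w x -> x' = x) -> push w u (w x) = u x.
Proof.
move=> ux; rewrite /push (@fsum_seq _ [:: x])//.
  by rewrite big_cons big_nil mem_set//= addr0.
by move=> x' wx' ux'; rewrite inE; apply/eqP/ux.
Qed.

Lemma push_inj (X : choiceType) (Y : Type) (w : X -> Y) (u : X -> R) x :
  injective w -> push w u (w x) = u x.
Proof. by move=> winj; apply: push_unique => x' _ /winj. Qed.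

(** Finite fibers rule out the default value 0 of a sum with infinitely many nonzero terms, for
    which additivity could fail. *)
Lemma push_add (X : choiceType) (Y : Type) (w : X -> Y) (u v : X -> R) :
  (forall y, finite_set [set x | u x != 0 /\ w x = y]) ->
  (forall y, finite_set [set x | v x != 0 /\ w x = y]) ->
  push w (fun x => u x + v x) = fun y => push w u y + push w v y.
Proof.
move=> fu fv; apply/funext => y.
pose s := (fset_set [set x | u x != 0 /\ w x = y] `|`
           fset_set [set x | v x != 0 /\ w x = y])%fset.
have su x : w x = y -> u x != 0 -> x \in s.
  by move=> wx ux; rewrite inE in_fset_set//= mem_set.
have sv x : w x = y -> v x != 0 -> x \in s.
  by move=> wx ux; rewrite inE !in_fset_set//= [X in _ || X]mem_set ?orbT.
rewrite /push !(@fsum_seq _ s)//; first by rewrite big_split.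
move=> x wx; have [ux|/su->//] := eqVneq (u x) 0.
by rewrite ux add0r; exact: sv.
Qed.

(** Fubini on one list [s], the fiber of the composite over [z]: each fiber of [w] lying over [z] is
    contained in it, so the inner sums are finite as well. *)
Lemma push_comp (X Y : choiceType) (Z : Type) (w : X -> Y) (v : Y -> Z)
    (u : X -> R) :
  (forall z, finite_set [set x | u x != 0 /\ v (w x) = z]) ->
  push v (push w u) = push (v \o w) u.
Proof.
move=> fu; apply/funext => z.
pose s : seq X := fset_set [set x | u x != 0 /\ v (w x) = z].
have us : uniq s by exact: fset_uniq.
have sE x : (x \in s) = `[< u x != 0 /\ v (w x) = z >].
  by rewrite in_fset_set//.
have inner y : v y = z -> push w u y = \sum_(x <- s | w x == y) u x.
  move=> vy; rewrite /push (fsum_seq us) => [|x wx ux].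
    by apply: eq_bigl => x; apply/idP/eqP => [/set_mem//|wx]; exact: mem_set.
  by rewrite sE; apply/asboolP; rewrite wx.
rewrite {1}/push (@fsum_seq _ (undup (map w s)))//; last 2 first.
- exact: undup_uniq.
- move=> y /= vy; rewrite inner// mem_undup => ny; apply: contraNT ny => nys.
  rewrite big_seq_cond big1// => x /andP[xs /eqP wx]; case/negP: nys.
  by rewrite -wx map_f.
rewrite (eq_bigr (fun y => \sum_(x <- s | w x == y) u x)); last first.
  by move=> y /set_mem /= /inner.
rewrite /push (fsum_seq us) => [|x wx ux]; last by rewrite sE; apply/asboolP.
rewrite big_seq_cond [RHS]big_seq_cond.
rewrite (eq_bigl [in undup (map w s)]); last first.
  move=> y; apply/andP/idP => [[]//|ys]; split => //; apply/mem_set => /=.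
  by move: ys; rewrite mem_undup => /mapP[x + ->]; rewrite sE => /asboolP[].
rewrite [RHS](eq_bigl [in s]); last first.
  move=> x; apply/andP/idP => [[]//|xs]; split => //; apply/mem_set => /=.
  by move: xs; rewrite sE => /asboolP[].
rewrite -big_seq -[RHS]big_seq.
under eq_bigr do rewrite big_mkcond.
rewrite exchange_big/= big_seq_cond [RHS]big_seq_cond.
apply: eq_bigr => x /andP[xs _]; rewrite -big_mkcond/=.
rewrite (eq_bigl (pred1 (w x))) => [|y]; last by rewrite /= eq_sym.
by rewrite -big_filter filter_pred1_uniq ?undup_uniq ?big_seq1// mem_undup map_f.
Qed.


Lemma push_tensor (X X' : choiceType) (Y Y' : Type) (w : X -> Y) (w' : X' -> Y')
    (u : X -> R) (u' : X' -> R) :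
  (forall y, finite_set [set x | u x != 0 /\ w x = y]) ->
  (forall y, finite_set [set x | u' x != 0 /\ w' x = y]) ->
  tensor (push w u) (push w' u') =
    push (fun p => (w p.1, w' p.2)) (tensor u u').
Proof.
move=> fu fu'; apply/funext => -[y y']; rewrite /tensor/=.
pose s : seq X := fset_set [set x | u x != 0 /\ w x = y].
pose s' : seq X' := fset_set [set x | u' x != 0 /\ w' x = y'].
have us : uniq s by exact: fset_uniq.
have us' : uniq s' by exact: fset_uniq.
have sE x : (x \in s) = `[< u x != 0 /\ w x = y >] by rewrite in_fset_set.
have sE' x : (x \in s') = `[< u' x != 0 /\ w' x = y' >] by rewrite in_fset_set.
rewrite /push (fsum_seq us); last by move=> x wx ux; rewrite sE; apply/asboolP.
rewrite (fsum_seq us'); last by move=> x wx ux; rewrite sE'; apply/asboolP.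
rewrite (@fsum_seq _ [seq (x, x') | x <- s, x' <- s']); last 2 first.
- by apply: allpairs_uniq => // -[? ?] [? ?] _ _ [-> ->].
- move=> [x x'] /= [wx wx']; rewrite mulf_eq0 negb_or => /andP[ux ux'].
  by rewrite allpairs_f// (sE, sE'); apply/asboolP.
have all (T : choiceType) (t : seq T) (P : pred T) (f : T -> R) :
    (forall x, x \in t -> P x) -> \sum_(x <- t | P x) f x = \sum_(x <- t) f x.
  move=> tP; rewrite big_seq_cond [RHS]big_seq; apply: eq_bigl => x.
  by apply: andb_idr; exact: tP.
rewrite all => [|x]; last by rewrite sE => /asboolP[_ wx]; exact: mem_set.
rewrite all => [|x]; last by rewrite sE' => /asboolP[_ wx]; exact: mem_set.
rewrite all => [|p /allpairsP[q [+ + ->]]]; last first.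
  rewrite sE sE' => /asboolP[_ wx] /asboolP[_ wx'].
  by apply: mem_set; rewrite /= wx wx'.
rewrite big_allpairs/= mulr_suml; apply: eq_bigr => x _.
by rewrite mulr_sumr.
Qed.

(** Both products are convolutions, that is, pushforwards of a tensor product along the law of
    exponents or of the group. Multiplicativity of the evaluation thus reduces to [weightD] and the
    composition of pushforwards. *)
Lemma gmul_push l (F G : gseries R l) :
  gmul F G = push (fun p => p.1 + p.2) (tensor F G).
Proof.
apply/funext => s; rewrite /gmul /push.
rewrite (@reindex_fsbig _ _ _ _ _ (fun r => (r, s - r)) setT)//.
split; first by move=> r _ /=; rewrite addrC subrK.
  by move=> r r' _ _ [].
move=> [r t] /= <-; exists r => //; by rewrite addrC addKr.
Qed.

Lemma hahn_mul_push (G : groupType) (E F : G -> R) :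
  hahn_mul E F = push (fun p => p.1 * p.2)%g (tensor E F).
Proof.
apply/funext => h; rewrite /hahn_mul /push.
rewrite (@reindex_fsbig _ _ _ _ _ (fun k => (k, k^-1 * h)%g) setT)//.
split; first by move=> r _ /=; rewrite mulKVg.
  by move=> r r' _ _ [].
by move=> [r t] /= <-; exists r => //; rewrite mulKg.
Qed.

(** Renamings, ramifications and blow-ups between generalized variables send monomials to monomials,
    so on series they merely move exponents. *)
Lemma gsubst_push l l' (tau : 'rV[R]_l -> 'rV[R]_l') (F : gseries R l) :
  gsubst (fun r => gmono (tau r)) F = push tau F.
Proof.
apply/funext => s; rewrite /gsubst /push fsbig_mkcond [RHS]fsbig_mkcond.
apply: eq_fsbigr => r _; rewrite /patch mem_setT /gmono.
case: ifPn => [/set_mem /= <-|]; first by rewrite eqxx mulr1.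
rewrite notin_setE /= => /eqP; rewrite eq_sym => /negbTE ->.
by rewrite mulr0.
Qed.

Lemma hahn_mul_mono (G : groupType) (g : G) (F : G -> R) h :
  hahn_mul (hahn_mono g) F h = F (g^-1 * h)%g.
Proof.
rewrite /hahn_mul (@fsum_seq _ [:: g])//.
  by rewrite big_cons big_nil mem_setT addr0 /hahn_mono eqxx mul1r.
move=> k _; rewrite inE /hahn_mono; case: (eqVneq k g) => //.
by rewrite mul0r eqxx.
Qed.

End Pushforward.

(** * Exponents and weights *)

Section ExponentField.
Context {R : realType} (A : fun_class R).

Let K := exponent_field A.

Lemma K_sub x y : K x -> K y -> K (x - y).
Proof.
by move=> Kx Ky S /[dup] + divS exS => -[_ + _]; apply; [exact: Kx|exact: Ky].
Qed.

Lemma K_div x y : K x -> K y -> K (x / y).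
Proof.
by move=> Kx Ky S /[dup] + divS exS => -[_ _ +]; apply; [exact: Kx|exact: Ky].
Qed.

Lemma K1 : K 1. Proof. by move=> S [S1 _ _] _. Qed.

Lemma K0 : K 0. Proof. by rewrite -(subrr 1); apply: K_sub; exact: K1. Qed.

Lemma K_opp x : K x -> K (- x).
Proof. by rewrite -sub0r; apply: K_sub; exact: K0. Qed.

Lemma K_add x y : K x -> K y -> K (x + y).
Proof. by move=> Kx /K_opp Ky; rewrite -[y]opprK; exact: K_sub. Qed.

Lemma K_inv x : K x -> K x^-1.
Proof. by rewrite -div1r; apply: K_div; exact: K1. Qed.

Lemma K_mul x y : K x -> K y -> K (x * y).
Proof. by move=> Kx /K_inv Ky; rewrite -[y]invrK; exact: K_div. Qed.

Lemma K_nat n : K n%:R.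
Proof. by elim: n => [|n IHn]; [exact: K0|rewrite -natr1; exact: K_add K1]. Qed.

Lemma K_ramifications x : ramifications A x -> K x.
Proof. by move=> [[_ /natrP[n ->]]|[_ []//]]; exact: K_nat. Qed.

(* In the classical case K is the field of rational numbers. *)
Lemma ramifications_ratio x y : K x -> K y -> 0 < x -> 0 < y ->
  exists a b, [/\ ramifications A a, ramifications A b, 0 < a, 0 < b &
    a * x = b * y].
Proof.
move=> Kx Ky x0 y0; have [cl|ncl] := pselect (classical A); last first.
  exists y, x; split=> //; rewrite 1?mulrC//.
  - by right; split=> //; split=> //; exact: ltW.
  - by right; split=> //; split=> //; exact: ltW.
have rat z : K z -> 0 < z -> exists p q : nat,
    [/\ (0 < p)%N, (0 < q)%N & z = p%:R / q%:R].
  (* An element of K lies in every subfield containing the exponents; here that subfield is the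
     image of the rationals. *)
  move=> Kz z0; have : z \in [pred u | `[< exists r : rat, u = ratr r >]].
    apply: Kz => [|u /cl /natrP[n ->]]; last first.
      by apply/asboolP; exists n%:R; rewrite ratr_nat.
    split=> [|u v /asboolP[r ->] /asboolP[s ->]|u v /asboolP[r ->] /asboolP[s ->]].
    - by apply/asboolP; exists 1; rewrite rmorph1.
    - by apply/asboolP; exists (r - s); rewrite rmorphB.
    - by apply/asboolP; exists (r / s); rewrite fmorph_div.
  move=> /asboolP[r zr]; move: z0; rewrite zr ltr0q => r0.
  have nr0 : 0 < numq r by rewrite numq_gt0.
  exists `|numq r|%N, `|denq r|%N; split.
  - by rewrite absz_gt0 gt_eqF.
  - by rewrite absz_gt0 gt_eqF// denq_gt0.
  - rewrite /ratr !natr_absz !gtr0_norm//; exact: denq_gt0.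
have [p [q [p0 q0 ->]]] := rat x Kx x0.
have [p' [q' [p'0 q'0 ->]]] := rat y Ky y0.
exists (p' * q)%:R, (p * q')%:R; split.
- by left; split=> //; exact: natr_nat.
- by left; split=> //; exact: natr_nat.
- by rewrite ltr0n muln_gt0 p'0.
- by rewrite ltr0n muln_gt0 p0.
rewrite !natrM -mulrA [q%:R * _]mulrC divfK ?pnatr_eq0 -?lt0n//.
by rewrite -mulrA [q'%:R * _]mulrC divfK ?pnatr_eq0 -?lt0n// mulrC.
Qed.

End ExponentField.

Definition Krow (R : realType) (A : fun_class R) l (r : 'rV[R]_l) : Prop :=
  forall i, exponent_field A (r 0 i).

Definition weight (R : realType) (G : groupType) (pow : G -> R -> G) l
  (g : 'I_l -> G) (r : 'rV[R]_l) : G := (\prod_(i < l) pow (g i) (r 0 i))%g.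

Section Weight.
Context {R : realType} (A : fun_class R) {G : groupType}.
Variables (le : rel G) (pow : G -> R -> G).
Hypothesis G_pow : ordered_group_with_powers (exponent_field A) le pow.

Let K := exponent_field A.
Let mulC := og_mulC G_pow.

Lemma og_refl : reflexive le. Proof. by have [[[]]] := og_order G_pow. Qed.
Lemma og_trans : transitive le. Proof. by have [[[]]] := og_order G_pow. Qed.
Lemma og_anti : antisymmetric le. Proof. by have [[]] := og_order G_pow. Qed.
Lemma og_total : total le. Proof. by have [] := og_order G_pow. Qed.

Lemma og_mulCA (a b c d : G) : (a * b * (c * d) = a * c * (b * d))%g.
Proof. by rewrite -!mulgA; congr (_ * _)%g; rewrite !mulgA [(b * c)%g]mulC. Qed.

Lemma og_le_mul2l (k g h : G) : le (k * g)%g (k * h)%g = le g h.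
Proof.
apply/idP/idP => [/(og_le_mul G_pow k^-1)|/(og_le_mul G_pow k)].
  by rewrite ![(k * _)%g]mulC !mulgK.
by rewrite ![(_ * k)%g]mulC.
Qed.

Lemma lt_of_mul2l (k g h : G) : lt_of le (k * g)%g (k * h)%g = lt_of le g h.
Proof. by rewrite /lt_of og_le_mul2l (inj_eq (mulgI k)). Qed.

Lemma lt_of_nle (g h : G) : lt_of le g h = ~~ le h g.
Proof.
rewrite /lt_of; have [<-|gh] := eqVneq g h; first by rewrite og_refl.
rewrite /=; apply/idP/idP => [gh'|nhg].
  by apply/negP => hg; move/eqP: gh; apply; apply: og_anti; rewrite gh'.
by have /orP[//|hg] := og_total g h; rewrite hg in nhg.
Qed.

Lemma og_mul_le1 (g h : G) : le g 1%g -> le h 1%g -> le (g * h)%g 1%g.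
Proof.
move=> g1 h1; apply: og_trans g1; rewrite -[X in le _ X]mulg1.
by rewrite og_le_mul2l.
Qed.

Lemma og_pow0 (g : G) : pow g 0 = 1%g.
Proof.
apply: (mulgI (pow g 0)); rewrite mulg1 -(og_powD G_pow) ?addr0//; exact: K0.
Qed.

Lemma og_pow1g r : K r -> pow 1%g r = 1%g.
Proof.
by move=> Kr; apply: (mulgI (pow 1%g r)); rewrite mulg1 -(og_mul_pow G_pow)// mulg1.
Qed.

Lemma og_pow_inv (g : G) r : K r -> pow g^-1%g r = (pow g r)^-1%g.
Proof.
move=> Kr; apply: (mulgI (pow g r)); rewrite -(og_mul_pow G_pow)// !mulgV.
exact: og_pow1g.
Qed.

Lemma og_pow_le1 (g : G) r : K r -> 0 <= r -> le g 1%g -> le (pow g r) 1%g.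
Proof.
move=> Kr r0 g1; have : le 1%g (pow g^-1%g r).
  by apply: (og_pow_ge1 G_pow) => //; rewrite -(og_le_mul2l g) mulg1 mulgV.
by rewrite og_pow_inv// -(og_le_mul2l (pow g r)) mulg1 mulgV.
Qed.

Lemma og_pow_eq1 (g : G) r : K r -> r != 0 -> pow g r = 1%g -> g = 1%g.
Proof.
move=> Kr r0 gr; rewrite -[g](og_pow1 G_pow) -(mulfV r0).
rewrite (og_powM G_pow)//; last exact: K_inv.
by rewrite gr og_pow1g//; exact: K_inv.
Qed.

Lemma Krow0 l : Krow A (0 : 'rV[R]_l).
Proof. by move=> i; rewrite mxE; exact: K0. Qed.

Lemma Krow_add l (r s : 'rV[R]_l) : Krow A r -> Krow A s -> Krow A (r + s).
Proof. by move=> Kr Ks i; rewrite mxE; exact: K_add. Qed.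

Lemma Krow_opp l (r : 'rV[R]_l) : Krow A r -> Krow A (- r).
Proof. by move=> Kr i; rewrite mxE; exact: K_opp. Qed.

Lemma Krow_delta l t (i : 'I_l) : K t -> Krow A (t *: delta_mx 0 i).
Proof.
by move=> Kt j; rewrite !mxE; apply: K_mul => //; case: (_ && _); [exact: K1|exact: K0].
Qed.

Section Tuple.
Context {l : nat} (g : 'I_l -> G).
Local Notation w := (weight pow g).

Lemma weightD r s : Krow A r -> Krow A s -> w (r + s) = (w r * w s)%g.
Proof.
move=> Kr Ks; rewrite /weight.
elim/big_rec3: _ => [|i x y z _ ->]; first by rewrite mulg1.
by rewrite mxE (og_powD G_pow)// og_mulCA.
Qed.

Lemma weight0 : w 0 = 1%g.
Proof. by rewrite /weight big1// => i _; rewrite mxE og_pow0. Qed.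

(** Reduces the preservation of weights under a change of variables to a check on multiples of basis
    vectors. *)
Lemma weight_ext (u : 'rV[R]_l -> G) r :
  (forall r s, Krow A r -> Krow A s -> u (r + s) = (u r * u s)%g) ->
  (forall (i : 'I_l) t, K t -> u (t *: delta_mx 0 i) = pow (g i) t) ->
  Krow A r -> u r = w r.
Proof.
move=> uD ud Kr; rewrite [in LHS](row_sum_delta r) /weight.
have u0 : u 0 = 1%g.
  apply: (mulgI (u 0)); rewrite mulg1 -uD ?addr0//; exact: Krow0.
suff [] : Krow A (\sum_(j < l) r 0 j *: delta_mx 0 j) /\
  u (\sum_(j < l) r 0 j *: delta_mx 0 j) = (\prod_(i < l) pow (g i) (r 0 i))%g by [].
elim/big_rec2: _ => [|i x y _ [Ky uy]]; first by split; [exact: Krow0|].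
have Kd := Krow_delta i (Kr i).
by split; [exact: Krow_add|rewrite (uD _ _ Kd Ky) uy (ud _ _ (Kr i))].
Qed.

Lemma weight_delta i t : K t -> w (t *: delta_mx 0 i) = pow (g i) t.
Proof.
move=> Kt; rewrite /weight.
have -> : (\prod_(j < l) pow (g j) ((t *: delta_mx 0 i : 'rV[R]_l) 0 j))%g =
    (\prod_(j < l) if j == i then pow (g j) t else 1)%g.
  apply: eq_bigr => j _; rewrite !mxE eqxx/=; case: eqVneq => _.
    by rewrite mulr1.
  by rewrite mulr0 og_pow0.
by rewrite -big_mkcond big_pred1_eq.
Qed.

Hypothesis g_lt1 : forall i, lt_of le (g i) 1%g.

Lemma weight_le1 r : Krow A r -> (forall i, 0 <= r 0 i) -> le (w r) 1%g.
Proof.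
move=> Kr r0; rewrite /weight; elim/big_rec: _ => [|i x _ x1]; first exact: og_refl.
apply: og_mul_le1 => //; apply: (og_pow_le1 (Kr i)) => //.
by have /andP[] := g_lt1 i.
Qed.

(** Splitting off coordinate [i] writes [w r] as a product of two factors at most 1. If the product
    is 1, so is [pow (g i) (r 0 i)], and [g i] would be 1 if [r 0 i] were nonzero. *)
Lemma weight_eq1 r : Krow A r -> (forall i, 0 <= r 0 i) -> w r = 1%g -> r = 0.
Proof.
move=> Kr r0 wr; apply/rowP => i; rewrite mxE; apply/eqP.
have /andP[gi1 gi] := g_lt1 i; apply: contraNT gi1 => ri.
pose d : 'rV[R]_l := r 0 i *: delta_mx 0 i.
have Kd : Krow A d by apply: Krow_delta; exact: Kr.
have w1 : le (w (r - d)) 1%g.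
  apply: weight_le1 => [|j]; first by apply: Krow_add => //; exact: Krow_opp.
  rewrite !mxE eqxx/=; case: eqVneq => [->|_]; first by rewrite mulr1 subrr.
  by rewrite mulr0 subr0.
have wE : w r = (pow (g i) (r 0 i) * w (r - d))%g.
  rewrite -(weight_delta i (Kr i)) -weightD//; first by rewrite addrC subrK.
  by apply: Krow_add => //; exact: Krow_opp.
apply/eqP; apply: (@og_pow_eq1 _ (r 0 i) (Kr i)) => //; apply: og_anti.
rewrite (og_pow_le1 (Kr i))//= -wr wE -[X in le _ X]mulg1 og_le_mul2l//.
Qed.

Lemma weight_le r s : Krow A r -> Krow A s -> (forall i, r 0 i <= s 0 i) ->
  le (w s) (w r).
Proof.
move=> Kr Ks rs; rewrite -(subrK r s) addrC.
have Kd : Krow A (s - r) by apply: Krow_add => //; exact: Krow_opp.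
rewrite weightD// -[X in le _ X]mulg1 og_le_mul2l; apply: weight_le1 => // i.
by rewrite !mxE subr_ge0.
Qed.

Lemma weight_inj r s : Krow A r -> Krow A s -> (forall i, r 0 i <= s 0 i) ->
  w r = w s -> r = s.
Proof.
move=> Kr Ks rs wrs.
have Kd : Krow A (s - r) by apply: Krow_add => //; exact: Krow_opp.
apply/eqP; rewrite eq_sym -subr_eq0; apply/eqP/weight_eq1 => //.
  by move=> i; rewrite !mxE subr_ge0.
by apply: (mulgI (w r)); rewrite -weightD// mulg1 addrC subrK.
Qed.

End Tuple.

(* The axioms on pow only concern exponents in K. *)
Definition K_series l (F : gseries R l) : Prop :=
  is_gseries l F /\ forall r, F r != 0 -> Krow A r.

Lemma K_series_fiber l (g : 'I_l -> G) (F : gseries R l) h :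
  (forall i, lt_of le (g i) 1%g) -> K_series F ->
  finite_set [set r | F r != 0 /\ weight pow g r = h].
Proof.
move=> g1 [[S Swo FS] KF].
apply: (@finite_weight_fiber R G _ _ (fun (r : 'rV[R]_l) (i : 'I_l) => r 0 i) S [set r | F r != 0]
  (weight pow g)).
- by move=> i; have [] := Swo i.
- by move=> r /FS rS i; have [] := rS i.
- by move=> r s /KF Kr /KF Ks; exact: weight_inj.
Qed.

Lemma K_series_hahn l (g : 'I_l -> G) (F : gseries R l) :
  (forall i, lt_of le (g i) 1%g) -> K_series F ->
  is_hahn le (hahn_eval pow F g).
Proof.
move=> g1 [[S Swo FS] KF].
apply: (@wo_weight_image R G le _ _ (fun (r : 'rV[R]_l) (i : 'I_l) => r 0 i) S [set r | F r != 0]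
  (weight pow g)).
- by move=> i; have [] := Swo i.
- by move=> r /FS rS i; have [] := rS i.
- by move=> r s /KF Kr /KF Ks; exact: weight_le.
- exact: og_refl.
- exact: og_trans.
- exact: og_total.
- exact: og_anti.
- move=> h Fh; apply/asboolP.
  by have [r Fr wr] := push_neq0 (Fh : push (weight pow g) F h != 0); exists r.
Qed.

(** A pair of exponents is a single family of coordinates indexed by ['I_l + 'I_l], to which the
    finite basis argument applies. This is the finiteness needed to evaluate a product of series. *)
Lemma K_series_pair_fiber l (g : 'I_l -> G) (F F' : gseries R l) h :
  (forall i, lt_of le (g i) 1%g) -> K_series F -> K_series F' ->
  finite_set [set p | tensor F F' p != 0 /\
    (weight pow g p.1 * weight pow g p.2)%g = h].
Proof.
move=> g1 [[S Swo FS] KF] [[S' S'wo FS'] KF'].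
pose c (p : 'rV[R]_l * 'rV[R]_l) (i : 'I_l + 'I_l) :=
  match i with inl i => p.1 0 i | inr i => p.2 0 i end.
pose SS (i : 'I_l + 'I_l) := match i with inl i => S i | inr i => S' i end.
have supp p : tensor F F' p != 0 -> F p.1 != 0 /\ F' p.2 != 0.
  by rewrite /tensor mulf_eq0 negb_or => /andP.
apply: (@finite_weight_fiber R G _ _ c SS [set p | tensor F F' p != 0]
  (fun p => weight pow g p.1 * weight pow g p.2)%g).
- by case=> i; [have [] := Swo i|have [] := S'wo i].
- move=> p /supp[/FS rS /FS' rS'] [i|i]; first by have [] := rS i.
  by have [] := rS' i.
move=> [r r'] [s s'] /supp[/KF/= Kr /KF'/= Kr'] /supp[/KF/= Ks /KF'/= Ks'] rs.
have rs1 i : r 0 i <= s 0 i by have := rs (inl i).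
have rs2 i : r' 0 i <= s' 0 i by have := rs (inr i).
have le1 := weight_le g1 Kr Ks rs1; have le2 := weight_le g1 Kr' Ks' rs2.
move=> e; have e1 : weight pow g r = weight pow g s.
  apply: og_anti; rewrite le1 andbT -(og_le_mul2l (weight pow g r')) mulC e.
  by rewrite [X in le _ X]mulC og_le_mul2l.
have e2 : weight pow g r' = weight pow g s' by apply: (mulgI (weight pow g r)); rewrite [in RHS]e1.
by rewrite (weight_inj g1 Kr Ks rs1 e1) (weight_inj g1 Kr' Ks' rs2 e2).
Qed.

End Weight.

(** * Germs of the class and their evaluation in the Hahn field *)

Section ClassGerms.
Context {R : realType} (A : fun_class R).
Hypothesis A_GQC : is_GQC A.

Let A_alg := GQC_algebras A_GQC.
Let A_ops := GQC_operations A_GQC.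
Let A_mor := GQC_morphism A_GQC.

Lemma germs_Krow l (f : 'rV[R]_l -> R) r : germs A l f ->
  hat A l f r != 0 -> Krow A r.
Proof. by move=> fA fr i S _; apply; exists l, f, r, i. Qed.

Lemma germs_K_series l (f : 'rV[R]_l -> R) : germs A l f ->
  K_series A (hat A l f).
Proof.
by move=> fA; split=> [|r]; [exact: (hat_gseries A_mor)|exact: germs_Krow].
Qed.

(** Cubes allow two germs to be restricted to a common radius, where the closure properties of [fam]
    apply. The minimum starts at 1, which keeps it positive in dimension 0 too. *)
Lemma germs_small m l (f : 'rV[R]_l -> R) : germs A m f ->
  exists2 e : R, 0 < e & forall d, 0 < d -> d <= e -> fam A m (const_mx d) f.
Proof.
move=> [ml [r r0 fr]]; exists (\big[Num.min/1]_i r 0 i).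
  by elim/big_ind: _ => // x y x0 y0; rewrite lt_min x0.
move=> d d0 de; apply: (fam_restrict A_ops) fr => // i; rewrite mxE//.
exact: le_trans de (bigmin_le _ _ _).
Qed.

Lemma small_germs m l (f : 'rV[R]_l -> R) (d : R) : (m <= l)%N -> 0 < d ->
  fam A m (const_mx d) f -> germs A m f.
Proof. by move=> ml d0 fd; split=> //; exists (const_mx d) => // i; rewrite mxE. Qed.

Lemma const_mx_positive l (d : R) : 0 < d -> positive_row (const_mx d : 'rV[R]_l).
Proof. by move=> d0 i; rewrite mxE. Qed.

Lemma germs_common m l m' l' (f : 'rV[R]_l -> R) (g : 'rV[R]_l' -> R) :
  germs A m f -> germs A m' g -> exists d : R,
    [/\ 0 < d, fam A m (const_mx d) f & fam A m' (const_mx d) g].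
Proof.
move=> /germs_small[d d0 fd] /germs_small[e e0 ge]; exists (Num.min d e); split.
- by rewrite lt_min d0.
- by apply: fd; rewrite ?ge_min ?lexx// lt_min d0.
- by apply: ge; rewrite ?ge_min ?lexx ?orbT// lt_min d0.
Qed.

Lemma germs_le m l (f : 'rV[R]_l -> R) : germs A m f -> (m <= l)%N.
Proof. by case. Qed.

Lemma germs_add m l (f g : 'rV[R]_l -> R) : germs A m f -> germs A m g ->
  germs A m (fun v => f v + g v).
Proof.
move=> fA gA; have [d [d0 fd gd]] := germs_common fA gA; have ml := germs_le fA.
apply: (small_germs ml d0); apply: (fam_add A_alg) => //.
exact: const_mx_positive.
Qed.

Lemma germs_mul m l (f g : 'rV[R]_l -> R) : germs A m f -> germs A m g ->
  germs A m (fun v => f v * g v).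
Proof.
move=> fA gA; have [d [d0 fd gd]] := germs_common fA gA; have ml := germs_le fA.
apply: (small_germs ml d0); apply: (fam_mul A_alg) => //.
exact: const_mx_positive.
Qed.

Lemma germs_cst m l (c : R) : (m <= l)%N -> germs A m (fun _ : 'rV[R]_l => c).
Proof.
move=> ml; apply: (small_germs ml ltr01); apply: (fam_cst A_alg) => //.
exact: const_mx_positive.
Qed.

Lemma germs_coord m l (i : 'I_l) : (m <= l)%N ->
  germs A m (fun v : 'rV[R]_l => v 0 i).
Proof.
move=> ml; apply: (small_germs ml ltr01); apply: (fam_coord A_ops) => //.
exact: const_mx_positive.
Qed.

Lemma germs_rename m l m' l' (p : 'I_l -> 'I_l') (f : 'rV[R]_l -> R) :
  (m' <= l')%N -> injective p -> (forall i : 'I_l, (i < m)%N -> (p i < m')%N) ->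
  germs A m f -> germs A m' (f \o pull p).
Proof.
move=> ml' pinj pm fA; have [d d0 fd] := germs_small fA; have ml := germs_le fA.
apply: (small_germs ml' d0); apply: (fam_rename A_ops ml ml' pinj pm).
  exact: const_mx_positive.
have -> : pull p (const_mx d) = const_mx d by apply/rowP => i; rewrite !mxE.
exact: fd.
Qed.

Lemma germs_zero m l (i : 'I_l.+1) (f : 'rV[R]_l.+1 -> R) : germs A m f ->
  germs A (m - (i < m)%N)%N (f \o ins i 0).
Proof.
move=> fA; have [d d0 fd] := germs_small fA; have ml := germs_le fA.
have ml' : (m - (i < m)%N <= l)%N.
  case: ltnP => [im|mi]; first by rewrite leq_subLR.
  by rewrite subn0; exact: leq_trans mi (ltn_ord i).
apply: (small_germs ml' d0).
have -> : const_mx d = col' i (const_mx d : 'rV[R]_l.+1).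
  by apply/rowP => j; rewrite !mxE.
apply: (fam_zero A_ops) => //; [exact: const_mx_positive|exact: fd].
Qed.

Lemma ins_col' l (i : 'I_l.+1) t (v : 'rV[R]_l.+1) : v 0 i = t ->
  ins i t (col' i v) = v.
Proof.
by move=> <-; apply/rowP => k; rewrite mxE; case: unliftP => [j|] -> //=; rewrite mxE.
Qed.

Lemma col'_ins l (i : 'I_l.+1) t (v : 'rV[R]_l) : col' i (ins i t v) = v.
Proof. by apply/rowP => j; rewrite !mxE liftK. Qed.

Lemma ins_at l (i : 'I_l.+1) (t : R) (v : 'rV[R]_l) : ins i t v 0 i = t.
Proof. by rewrite mxE unlift_none. Qed.

Lemma ins_lift l (i : 'I_l.+1) j (t : R) (v : 'rV[R]_l) :
  ins i t v 0 (lift i j) = v 0 j.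
Proof. by rewrite mxE liftK. Qed.

Lemma gsubst_zero l (i : 'I_l.+1) (F : gseries R l.+1) s :
  gsubst (fun r s => if r 0 i == 0 then gmono (col' i r) s else 0) F s =
  F (ins i 0 s).
Proof.
rewrite /gsubst (@fsum_seq _ _ [:: ins i 0 s])//.
  by rewrite big_cons big_nil mem_setT addr0 ins_at eqxx col'_ins /gmono eqxx mulr1.
move=> r _; rewrite inE; apply: contraNT => r0; apply/eqP.
case: eqP => [ri|]; last by rewrite mulr0.
rewrite /gmono; case: eqP => [rc|]; last by rewrite mulr0.
by rewrite rc ins_col' ?eqxx in r0.
Qed.

Lemma hat_ins0 m l (i : 'I_l.+1) (f : 'rV[R]_l.+1 -> R) s : germs A m f ->
  hat A (m - (i < m)%N)%N (f \o ins i 0) s = hat A m f (ins i 0 s).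
Proof. by move=> fA; rewrite (hat_zero A_mor)// gsubst_zero. Qed.

(** Compatibility with setting a variable to 0 removes the variables one by one, until [f] is a
    constant. *)
Lemma hat_at0 l (f : 'rV[R]_l -> R) : germs A l f -> hat A l f 0 = f 0.
Proof.
elim: l f => [|l IHl] f fA.
  have -> : f = fun=> f 0 by apply/funext => v; congr f; apply/rowP => -[].
  by rewrite (hat_cst A_mor)// /gmono eqxx mulr1.
have ins0 : ins ord0 0 0 = 0 :> 'rV[R]_l.+1.
  by apply/rowP => k; rewrite !mxE; case: unliftP => [j|] _ //=; rewrite mxE.
have := hat_ins0 ord0 0 fA; have := germs_zero ord0 fA.
by rewrite ?ltn0Sn subn1 /= => /IHl ->; rewrite /= ins0.
Qed.

Section Eval.
Context {G : groupType} (le : rel G) (pow : G -> R -> G).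
Hypothesis G_pow : ordered_group_with_powers (exponent_field A) le pow.

Local Notation lt1 g := (lt_of le g 1%g).

Definition Ev l (f : 'rV[R]_l -> R) (g : 'I_l -> G) : G -> R :=
  hahn_eval pow (hat A l f) g.

Lemma hahn_evalE l (F : gseries R l) (g : 'I_l -> G) :
  hahn_eval pow F g = push (weight pow g) F.
Proof. by []. Qed.

Lemma Ev_support l (f : 'rV[R]_l -> R) (g : 'I_l -> G) h :
  Ev f g h != 0 -> exists2 r, hat A l f r != 0 & weight pow g r = h.
Proof. exact: push_neq0. Qed.

(** Moving exponents by [tau] while replacing the arguments [g] by [g'] leaves every weight
    unchanged, so the two evaluations group the same coefficients. *)
Lemma eval_push l l' (tau : 'rV[R]_l -> 'rV[R]_l') (F : gseries R l)
    (g : 'I_l -> G) (g' : 'I_l' -> G) :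
  (forall i, lt1 (g i)) -> K_series A F ->
  (forall r, Krow A r -> weight pow g' (tau r) = weight pow g r) ->
  hahn_eval pow (push tau F) g' = hahn_eval pow F g.
Proof.
move=> g1 FK gg'; have [_ KF] := FK.
rewrite !hahn_evalE push_comp => [|z]; first by apply: eq_push => r /KF/gg'.
apply: sub_finite_set (K_series_fiber G_pow z g1 FK) => r [Fr <-].
by split=> //; rewrite gg'//; exact: KF.
Qed.

Lemma Ev_add l (f f' : 'rV[R]_l -> R) (g : 'I_l -> G) :
  (forall i, lt1 (g i)) -> germs A l f -> germs A l f' ->
  Ev (fun v => f v + f' v) g = hahn_add (Ev f g) (Ev f' g).
Proof.
move=> g1 fA f'A; rewrite /Ev (hat_add A_mor)// !hahn_evalE push_add//.
  by move=> y; apply: (K_series_fiber G_pow y g1); exact: germs_K_series.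
by move=> y; apply: (K_series_fiber G_pow y g1); exact: germs_K_series.
Qed.

Lemma Ev_mul l (f f' : 'rV[R]_l -> R) (g : 'I_l -> G) :
  (forall i, lt1 (g i)) -> germs A l f -> germs A l f' ->
  Ev (fun v => f v * f' v) g = hahn_mul (Ev f g) (Ev f' g).
Proof.
move=> g1 fA f'A; have fK := germs_K_series fA; have f'K := germs_K_series f'A.
have supp p : tensor (hat A l f) (hat A l f') p != 0 -> Krow A p.1 /\ Krow A p.2.
  by rewrite /tensor mulf_eq0 negb_or => /andP[/(fK.2)? /(f'K.2)].
have wD p : tensor (hat A l f) (hat A l f') p != 0 ->
    weight pow g (p.1 + p.2) = (weight pow g p.1 * weight pow g p.2)%g.
  by move=> /supp[K1 K2]; exact: (weightD G_pow).
rewrite /Ev (hat_mul A_mor)// hahn_mul_push !hahn_evalE.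
rewrite push_tensor; [|by move=> y; exact: (K_series_fiber G_pow y g1)..].
rewrite gmul_push push_comp => [|z]; last first.
  apply: sub_finite_set (K_series_pair_fiber G_pow z g1 fK f'K) => p [p0 <-].
  by split=> //; rewrite wD.
rewrite push_comp => [|z]; last exact: (K_series_pair_fiber G_pow z g1 fK f'K).
exact: eq_push.
Qed.

Lemma push_gmono (Y : Type) l (w : 'rV[R]_l -> Y) (c : R) e :
  push w (fun s => c * gmono e s) = fun y => c * (`[< w e = y >])%:R.
Proof.
apply/funext => y; rewrite /push (@fsum_seq _ _ [:: e])//; last first.
  by move=> r _; rewrite inE /gmono; case: (eqVneq r e) => //= _; rewrite mulr0 eqxx.
rewrite big_cons big_nil /gmono eqxx mulr1.
case: asboolP => wy; first by rewrite mem_set// mulr1 addr0.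
by rewrite memNset// mulr0.
Qed.

Lemma Ev_cst l (c : R) (g : 'I_l -> G) :
  Ev (fun=> c) g = fun h => c * hahn_mono 1%g h.
Proof.
rewrite /Ev (hat_cst A_mor)// hahn_evalE push_gmono.
apply/funext => h; rewrite (weight0 G_pow) /hahn_mono [h == _]eq_sym.
by congr (_ * (nat_of_bool _)%:R); apply/asboolP/eqP.
Qed.

Lemma Ev_coord l (i : 'I_l) (g : 'I_l -> G) :
  Ev (fun v => v 0 i) g = hahn_mono (g i).
Proof.
rewrite /Ev (hat_coord A_mor)//.
have -> : gmono (delta_mx 0 i) = (fun s : 'rV[R]_l => 1 * gmono (1 *: delta_mx 0 i) s).
  by apply/funext => s; rewrite scale1r mul1r.
rewrite hahn_evalE push_gmono; apply/funext => h.
rewrite (weight_delta G_pow); last exact: K1.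
rewrite (og_pow1 G_pow) mul1r /hahn_mono [h == _]eq_sym.
by congr ((nat_of_bool _)%:R); apply/asboolP/eqP.
Qed.

Lemma Ev_rename l l' (p : 'I_l -> 'I_l') (f : 'rV[R]_l -> R) (g : 'I_l' -> G) :
  injective p -> (forall i, lt1 (g i)) -> germs A l f ->
  Ev (f \o pull p) g = Ev f (g \o p).
Proof.
move=> pinj g1 fA; rewrite /Ev (@hat_rename _ _ A_mor l)// gsubst_push.
apply: eval_push => //; [by move=> i; exact: g1|exact: germs_K_series|].
move=> r Kr; apply: (weight_ext (u := fun r => weight pow g
  (\row_j \sum_(i | p i == j) r 0 i))) => //= [{Kr}r s Kr Ks|i t Kt].
  rewrite -(weightD G_pow).
  - by congr weight; apply/rowP => j; rewrite !mxE -big_split/=; apply: eq_bigr => i _; rewrite mxE.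
  - move=> j; rewrite mxE; elim/big_ind: _ => //; [exact: K0|exact: K_add].
  - move=> j; rewrite mxE; elim/big_ind: _ => //; [exact: K0|exact: K_add].
rewrite -(weight_delta G_pow)//; congr weight; apply/rowP => j; rewrite !mxE eqxx/=.
have [->|ji] := eqVneq j (p i).
  rewrite (big_pred1 i) => [|k]; first by rewrite !mxE !eqxx.
  by rewrite /= (inj_eq pinj).
rewrite mulr0 big1// => k /eqP pk; rewrite !mxE eqxx/=; case: eqP => [ki|_].
  by rewrite -pk ki eqxx in ji.
by rewrite mulr0.
Qed.

End Eval.

End ClassGerms.

(** * Germs at infinity and monomials *)

Section GermTheory.
Context {R : realType}.
Implicit Types (f g : R -> R) (a b m n : germ R).

Lemma germ_of_addE f g : germ_of f + germ_of g = germ_of (fun x => f x + g x).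
Proof.
apply/germ_ofP; near=> x.
have -> : repr (germ_of f) x = f x by near: x; exact: repr_germ_of.
have -> : repr (germ_of g) x = g x by near: x; exact: repr_germ_of.
by [].
Unshelve. all: by end_near. Qed.

Lemma germ_of_mulE f g : germ_of f * germ_of g = germ_of (fun x => f x * g x).
Proof.
apply/germ_ofP; near=> x.
have -> : repr (germ_of f) x = f x by near: x; exact: repr_germ_of.
have -> : repr (germ_of g) x = g x by near: x; exact: repr_germ_of.
by [].
Unshelve. all: by end_near. Qed.

Lemma germ_of_prod (I : Type) (s : seq I) (P : pred I) (F : I -> R -> R) :
  \prod_(i <- s | P i) germ_of (F i) =
  germ_of (fun x => \prod_(i <- s | P i) F i x).
Proof.
elim: s => [|i s IHs].
  by rewrite big_nil; congr germ_of; apply/funext => x; rewrite big_nil.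
have -> : (fun x => \prod_(i <- i :: s | P i) F i x) =
    (fun x => if P i then F i x * \prod_(j <- s | P j) F j x
              else \prod_(j <- s | P j) F j x).
  by apply/funext => x; rewrite big_cons.
by rewrite big_cons IHs; case: ifP => // _; rewrite germ_of_mulE.
Qed.

Lemma germ_of_oppE f : - germ_of f = germ_of (fun x => - f x).
Proof.
apply/germ_ofP; near=> x.
by have -> : repr (germ_of f) x = f x by near: x; exact: repr_germ_of.
Unshelve. all: by end_near. Qed.

Lemma germ_reprK a : germ_of (repr a) = a.
Proof. by rewrite /germ_of reprK. Qed.

Lemma repr_add a b : \forall x \near +oo, repr (a + b) x = repr a x + repr b x.
Proof. exact: repr_germ_of. Qed.

Lemma repr_mul a b : \forall x \near +oo, repr (a * b) x = repr a x * repr b x.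
Proof. exact: repr_germ_of. Qed.

Lemma repr_opp a : \forall x \near +oo, repr (- a) x = - repr a x.
Proof. exact: repr_germ_of. Qed.

Lemma repr_sub a b : \forall x \near +oo, repr (a - b) x = repr a x - repr b x.
Proof.
near=> x; have -> : repr (a - b) x = repr a x + repr (- b) x.
  by near: x; exact: repr_add.
by congr (_ + _); near: x; exact: repr_opp.
Unshelve. all: by end_near. Qed.

Lemma repr_1 : \forall x \near +oo, repr (1 : germ R) x = 1.
Proof. exact: repr_germ_of. Qed.

Lemma repr_0 : \forall x \near +oo, repr (0 : germ R) x = 0.
Proof. exact: repr_germ_of. Qed.

Lemma germ_le_refl a : germ_le a a.
Proof. by near=> x. Unshelve. all: by end_near. Qed.

Lemma germ_le_anti a b : germ_le a b -> germ_le b a -> a = b.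
Proof.
move=> ab ba; apply: germ_ext; near=> x; apply: le_anti; apply/andP; split.
  by near: x.
by near: x.
Unshelve. all: by end_near. Qed.

Definition mrow l (m : 'I_l -> germ R) (x : R) : 'rV[R]_l := \row_i repr (m i) x.

Lemma germ_compE l (u : 'rV[R]_l -> R) (m : 'I_l -> germ R) :
  germ_comp u m = germ_of (fun x => u (mrow m x)).
Proof. by []. Qed.

Lemma comp_add l (u v : 'rV[R]_l -> R) (m : 'I_l -> germ R) :
  germ_comp (fun w => u w + v w) m = germ_comp u m + germ_comp v m.
Proof. by rewrite !germ_compE germ_of_addE. Qed.

Lemma comp_mul l (u v : 'rV[R]_l -> R) (m : 'I_l -> germ R) :
  germ_comp (fun w => u w * v w) m = germ_comp u m * germ_comp v m.
Proof. by rewrite !germ_compE germ_of_mulE. Qed.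

Lemma comp_cst l (c : R) (m : 'I_l -> germ R) :
  germ_comp (fun=> c) m = germ_cst c.
Proof. by []. Qed.

Lemma comp_coord l (i : 'I_l) (m : 'I_l -> germ R) :
  germ_comp (fun v => v 0 i) m = m i.
Proof.
rewrite germ_compE -[RHS]germ_reprK; congr germ_of; apply/funext => x.
by rewrite mxE.
Qed.

Lemma comp_rename l l' (p : 'I_l -> 'I_l') (u : 'rV[R]_l -> R)
    (m : 'I_l' -> germ R) : germ_comp (u \o pull p) m = germ_comp u (m \o p).
Proof.
rewrite !germ_compE; congr germ_of; apply/funext => x /=; congr u.
by apply/rowP => i; rewrite !mxE.
Qed.

Lemma comp_subst l l' (sigma : 'rV[R]_l' -> 'rV[R]_l) (u : 'rV[R]_l -> R)
    (m : 'I_l -> germ R) (n : 'I_l' -> germ R) :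
  (\forall x \near +oo, sigma (mrow n x) = mrow m x) ->
  germ_comp (u \o sigma) n = germ_comp u m.
Proof. by move=> h; apply/germ_ofP; apply: filterS h => x /= ->. Qed.

End GermTheory.

Record setting (R : realType) (A : fun_class R) (G : groupType) (le : rel G)
    (pow : G -> R -> G) (M : set (germ R)) (phi : germ R -> G) : Prop := {
  set_GQC : is_GQC A;
  set_powers : ordered_group_with_powers (exponent_field A) le pow;
  set_monomials : monomial_group M;
  set_M_pow : forall m r, M m -> exponent_field A r -> M (germ_pow m r);
  set_phi : ordered_group_embedding le M phi;
  set_phi_pow : forall m r, M m -> exponent_field A r ->
    phi (germ_pow m r) = pow (phi m) r }.

Definition small (R : realType) (M : set (germ R)) (m : germ R) : Prop :=
  M m /\ germ_lt m 1.

Section Monomials.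
Context {R : realType} (A : fun_class R).
Context (G : groupType) (le : rel G) (pow : G -> R -> G).
Context (M : set (germ R)) (phi : germ R -> G).
Hypothesis S : setting A le pow M phi.

Let A_GQC := set_GQC S.
Let G_pow := set_powers S.
Let M_group := set_monomials S.
Let M_pow := set_M_pow S.
Let phi_emb := set_phi S.
Let phi_pow := set_phi_pow S.
Let K := exponent_field A.
Local Notation small := (small M).

Lemma phi1 : phi 1 = 1%g.
Proof.
have M1 := mg_one M_group.
by apply: (mulgI (phi 1)); rewrite mulg1 -(oge_mul phi_emb)// mulr1.
Qed.

Lemma phi_inj m n : M m -> M n -> phi m = phi n -> m = n.
Proof.
move=> Mm Mn mn; apply: germ_le_anti; apply/(oge_le phi_emb) => //; rewrite mn;
exact: (og_refl G_pow).
Qed.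

Lemma small_lt1 m : small m -> lt_of le (phi m) 1%g.
Proof.
move=> [Mm [m1 mle1]]; have M1 := mg_one M_group; rewrite -phi1.
apply/andP; split; last exact/(oge_le phi_emb).
by apply/eqP => /(phi_inj Mm M1).
Qed.

Lemma lt1_small m : M m -> lt_of le (phi m) 1%g -> small m.
Proof.
move=> Mm /andP[m1 mle1]; split=> //; split; last first.
  by apply/(oge_le phi_emb) => //; [exact: mg_one|rewrite phi1].
by move=> m1'; rewrite m1' phi1 eqxx in m1.
Qed.

Lemma M_div m n : M m -> M n ->
  exists q, [/\ M q, m = n * q & phi q = ((phi n)^-1 * phi m)%g].
Proof.
move=> Mm Mn; have [n' Mn' nn'] := mg_inv M_group Mn.
exists (n' * m); split; first exact: mg_mul.
  by rewrite mulrA nn' mul1r.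
rewrite (oge_mul phi_emb)//; congr (_ * _)%g; apply: (mulgI (phi n)).
by rewrite -(oge_mul phi_emb)// nn' phi1 mulgV.
Qed.

Lemma small_pow m r : small m -> K r -> 0 < r -> small (germ_pow m r).
Proof.
move=> sm Kr r0; have [Mm _] := sm; have /andP[m1 mle1] := small_lt1 sm.
apply: lt1_small; first exact: M_pow.
rewrite phi_pow//; apply/andP; split; last by apply: (og_pow_le1 G_pow) => //; exact: ltW.
by apply: contraNneq m1 => /(og_pow_eq1 G_pow Kr) ->//; rewrite gt_eqF.
Qed.

(** By totality of the order on monomials, [m] or its inverse has a finite limit. A nonzero limit of
    [m] would make [m] and 1 comparable both ways, hence equal; a finite limit of the inverse is at
    least 1 because [m] is below 1 pointwise, so it would give such a nonzero limit. *)
Lemma small_cvg0 m : small m -> repr m x @[x --> +oo] --> 0.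
Proof.
move=> [Mm [m1 mle1]]; have M1 := mg_one M_group.
have r1 := @repr_1 R.
have cvg_cst (c : R) : germ_preceq m 1 -> c != 0 -> repr m x @[x --> +oo] --> (c : R) -> False.
  move=> m_le c0 mc; apply: m1; apply: (mg_anti M_group) => //; exists c^-1.
  apply: cvg_trans (cvgV c0 mc); apply: near_eq_cvg.
  by apply: filterS r1 => x ->; rewrite div1r.
have m_cvg (c : R) : repr m x @[x --> +oo] --> (c : R) -> germ_preceq m 1.
  move=> mc; exists c; apply: cvg_trans mc; apply: near_eq_cvg.
  by apply: filterS r1 => x ->; rewrite divr1.
have [[c mc]|[c mc]] := mg_total M_group Mm M1.
  have {}mc : repr m x @[x --> +oo] --> (c : R).
    apply: cvg_trans mc; apply: near_eq_cvg.
    by apply: filterS r1 => x ->; rewrite divr1.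
  have [c0|c0] := eqVneq c 0; first by rewrite -c0.
  by have := cvg_cst c (m_cvg c mc) c0 mc.
have {}mc : (repr m x)^-1 @[x --> +oo] --> c.
  apply: cvg_trans mc; apply: near_eq_cvg.
  by apply: filterS r1 => x ->; rewrite div1r.
have c1 : 1 <= c.
  apply: (cvgr_to_ge mc); near=> x; have m0 : 0 < repr m x by near: x; exact: (mg_pos M_group Mm).
  rewrite invf_ge1//.
  have <- : repr (1 : germ R) x = 1 by near: x; exact: r1.
    by near: x; exact: mle1.
have c0 : c != 0 by rewrite gt_eqF// (lt_le_trans ltr01).
have {}mc : repr m x @[x --> +oo] --> c^-1.
  by apply: cvg_trans (cvgV c0 mc); apply: near_eq_cvg; near=> x; rewrite /= invrK.
by have := cvg_cst _ (m_cvg _ mc) (invr_neq0 c0) mc.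
Unshelve. all: by end_near. Qed.

Lemma small_near m (d : R) : small m -> 0 < d ->
  \forall x \near +oo, 0 < repr m x /\ repr m x < d.
Proof.
move=> sm d0; near=> x; split; near: x; first exact: (mg_pos M_group sm.1).
exact: (cvgr_lt _ (small_cvg0 sm)).
Unshelve. all: by end_near. Qed.

Section Row.
Context {l : nat} (m : 'I_l -> germ R).
Hypothesis m_small : forall i, small (m i).

Lemma mrow_near (d : R) : 0 < d ->
  \forall x \near +oo, forall i, 0 < mrow m x 0 i /\ mrow m x 0 i < d.
Proof.
move=> d0; apply: filter_forall => i.
by apply: filterS (small_near (m_small i) d0) => x; rewrite mxE.
Qed.

Lemma mrow_Ihat (r : 'rV[R]_l) : positive_row r ->
  \forall x \near +oo, Ihat l r (mrow m x).
Proof.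
move=> r0; apply: filter_forall => i; rewrite ltn_ord.
apply: filterS (small_near (m_small i) (r0 i)) => x; rewrite mxE.
by move=> [/ltW].
Qed.

Lemma comp_ext (u v : 'rV[R]_l -> R) : origin_eq l u v ->
  germ_comp u m = germ_comp v m.
Proof.
move=> [r r0 uv]; apply/germ_ofP.
by apply: filterS (mrow_Ihat r0) => x /uv.
Qed.

Lemma comp_cvg (u : 'rV[R]_l -> R) : germs A l u ->
  repr (germ_comp u m) x @[x --> +oo] --> u 0.
Proof.
move=> [_ [r r0 ru]].
have uc := fam_continuous (GQC_algebras A_GQC) (leqnn l) r0 ru.
have : u (mrow m x) @[x --> +oo] --> u 0.
  have I0 : Ihat l r 0.
    by move=> i; rewrite ltn_ord !mxE; split=> //; exact: r0.
  have uc0 := (subspace_continuousP _ _).1 uc 0 I0.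
  (* Continuity of [u] is only known within the polydisk; the arguments stay inside it because
     monomials are positive. *)
  have mc : mrow m x @[x --> +oo] --> within (Ihat l r) (nbhs (0 : 'rV[R]_l)).
    move=> P /nbhs_ballP[e /= e0 eP].
    suff : \forall x \near +oo, P (mrow m x) by [].
    near=> x.
    apply: eP; last by near: x; exact: mrow_Ihat.
    split=> // i j; rewrite ord1 mxE /ball /= sub0r normrN.
    have : 0 < mrow m x 0 j /\ mrow m x 0 j < e.
      by move: j; near: x; exact: mrow_near.
    by case=> m0 me; rewrite gtr0_norm.
  exact: (cvg_comp _ _ mc uc0).
apply: cvg_trans; apply: near_eq_cvg.
by apply: filterS (repr_germ_of (fun x => u (mrow m x))) => x ->.
Unshelve. all: by end_near. Qed.

Definition mono (r : 'rV[R]_l) : germ R := \prod_(i < l) germ_pow (m i) (r 0 i).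

Lemma M_mono r : Krow A r -> M (mono r).
Proof.
move=> Kr; rewrite /mono; elim/big_ind: _ => [|u v|i _].
- exact: mg_one.
- exact: mg_mul.
- by apply: M_pow; [have [] := m_small i|exact: Kr].
Qed.

Lemma phi_mono r : Krow A r -> phi (mono r) = weight pow (phi \o m) r.
Proof.
move=> Kr; rewrite /mono /weight.
suff [] : M (\prod_(i < l) germ_pow (m i) (r 0 i)) /\
  phi (\prod_(i < l) germ_pow (m i) (r 0 i)) =
  (\prod_(i < l) pow (phi (m i)) (r 0 i))%g by [].
elim/big_rec2: _ => [|i y x _ [Mx <-]]; first by split; [exact: mg_one|exact: phi1].
have [Mi _] := m_small i; split.
  by apply: mg_mul => //; apply: M_pow => //; exact: Kr.
rewrite (oge_mul phi_emb)//; last by apply: M_pow => //; exact: Kr.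
by rewrite phi_pow//; exact: Kr.
Qed.

Lemma comp_monomial r : germ_comp (monomial_fun l r) m = mono r.
Proof.
rewrite /mono /germ_pow germ_of_prod; congr germ_of; apply/funext => x.
by apply: eq_bigr => i _; rewrite ltn_ord mxE.
Qed.

End Row.

End Monomials.

(** * Monomial changes of variables *)

Section Reduction.
Context {R : realType} (A : fun_class R).
Context (G : groupType) (le : rel G) (pow : G -> R -> G).
Context (M : set (germ R)) (phi : germ R -> G).
Hypothesis S : setting A le pow M phi.

Let A_GQC := set_GQC S.
Let G_pow := set_powers S.
Let M_group := set_monomials S.
Let phi_emb := set_phi S.
Let phi_pow := set_phi_pow S.
Let A_clo := GQC_closed A_GQC.
Let K := exponent_field A.
Local Notation small := (small M).

(** The germ and the evaluated series are transported together, so that a leading term found for [b]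
    serves both sides for [a]. *)
Definition same_germ l (a : 'rV[R]_l -> R) (m : 'I_l -> germ R)
    l' (b : 'rV[R]_l' -> R) (n : 'I_l' -> germ R) : Prop :=
  germ_comp a m = germ_comp b n /\ Ev A pow a (phi \o m) = Ev A pow b (phi \o n).

Definition reduces l (m : 'I_l -> germ R) l' (n : 'I_l' -> germ R) : Prop :=
  (forall i, small (n i)) /\
  forall a, germs A l a -> exists2 b, germs A l' b & same_germ a m b n.

(** The finite basis of the support is computed once, for the initial series. Monotonicity of [tau]
    and the description of the new support ensure that the image of this basis still lies below
    every exponent of the transformed series. *)
Record monomial_change l (m n : 'I_l -> germ R) (tau : 'rV[R]_l -> 'rV[R]_l) :
    Prop := {
  mc_small : forall i, small (n i);
  mc_mono : forall r s : 'rV[R]_l, (forall i, r 0 i <= s 0 i) ->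
    forall i, tau r 0 i <= tau s 0 i;
  mc_Krow : forall r, Krow A r -> Krow A (tau r);
  mc_germ : forall a, germs A l a -> exists b,
    [/\ germs A l b, same_germ a m b n,
        forall r, hat A l b (tau r) = hat A l a r &
        forall s, hat A l b s != 0 -> exists2 r, hat A l a r != 0 & s = tau r] }.

Lemma mc_refl l (m : 'I_l -> germ R) : (forall i, small (m i)) ->
  monomial_change m m id.
Proof.
move=> sm; split=> // a aA; exists a; split=> // s s0; by exists s.
Qed.

Lemma mc_comp l (m n p : 'I_l -> germ R) tau tau' :
  monomial_change m n tau -> monomial_change n p tau' ->
  monomial_change m p (tau' \o tau).
Proof.
move=> [_ mono1 K1 g1] [sm mono2 K2 g2]; split=> //=.
- by move=> r s rs; apply: mono2; exact: mono1.
- by move=> r /K1/K2.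
move=> a /g1[b [/g2[c [cA [bc1 bc2] cb cs]] [ab1 ab2] ba bs]]; exists c; split=> //.
- by split; [rewrite ab1|rewrite ab2].
- by move=> r; rewrite cb.
by move=> s /cs[r /bs[t at0 ->] ->]; exists t.
Qed.

(** Injectivity of [tau] prevents coefficients from merging; its additivity reduces the comparison
    of weights to basis vectors. *)
Lemma mc_subst l (m n : 'I_l -> germ R) (sigma tau : 'rV[R]_l -> 'rV[R]_l) :
  closed_under_subst A l l sigma (fun r => gmono (tau r)) ->
  (forall i, small (m i)) -> (forall i, small (n i)) -> injective tau ->
  (forall r s : 'rV[R]_l, (forall i, r 0 i <= s 0 i) ->
    forall i, tau r 0 i <= tau s 0 i) ->
  (forall r, Krow A r -> Krow A (tau r)) ->
  (forall r s, tau (r + s) = tau r + tau s) ->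
  (forall (i : 'I_l) t, K t ->
    weight pow (phi \o n) (tau (t *: delta_mx 0 i)) = pow (phi (m i)) t) ->
  (\forall x \near +oo, sigma (mrow n x) = mrow m x) ->
  monomial_change m n tau.
Proof.
move=> clo sm sn tinj tmono tK tD tdelta sigmaE; split=> // a aA.
have [bA hatb] := clo a aA; rewrite gsubst_push in hatb.
exists (a \o sigma); split=> //.
- split; first by rewrite (comp_subst _ sigmaE).
  rewrite /Ev hatb (eval_push G_pow (g := phi \o m))//.
  + by move=> i /=; apply: (small_lt1 S).
  + exact: germs_K_series.
  move=> r Kr; apply: (@weight_ext _ A G pow l (phi \o m) (weight pow (phi \o n) \o tau)) => //=.
  by move=> r' s' Kr' Ks'; rewrite tD (weightD G_pow)//; exact: tK.
- by move=> r; rewrite hatb push_inj.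
by move=> s; rewrite hatb => sN0; have [r ar <-] := push_neq0 sN0; exists r.
Qed.

Lemma mc_ramification l (m : 'I_l -> germ R) i c :
  (forall i, small (m i)) -> ramifications A c -> 0 < c ->
  exists2 n, monomial_change m n (fun r => upd i (c * r 0 i) r) &
    forall k, k != i -> n k = m k.
Proof.
move=> sm rc c0; have Kc := K_ramifications rc; have Kc' := K_inv Kc.
(* Substituting the power [c] for the variable is compensated by taking the power [c^-1] of the
   argument. In the classical case [c] is an integer while [c^-1] need not be one, but monomials
   admit all powers in K. *)
pose n k := if k == i then germ_pow (m i) c^-1 else m k.
exists n => [|k /negbTE ki]; last by rewrite /n ki.
have sn k : small (n k).
  rewrite /n; case: eqP => _ //; apply: (small_pow S) => //.
  by rewrite invr_gt0.
apply: (mc_subst (closed_ramif A_clo (ltn_ord i) rc c0)) => //.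
- move=> r s /rowP rs; apply/rowP => k; have := rs k; rewrite !mxE.
  by case: eqP => // -> /mulfI; apply; rewrite gt_eqF.
- move=> r s rs k; rewrite !mxE; case: eqP => // _.
  by rewrite ler_pM2l.
- by move=> r Kr k; rewrite mxE; case: eqP => // _; apply: K_mul.
- move=> r s; apply/rowP => k; rewrite !mxE; case: eqP => // _.
  by rewrite mulrDr.
- move=> k t Kt; have [->|ki] := eqVneq k i.
    have -> : upd i (c * (t *: delta_mx 0 i : 'rV[R]_l) 0 i) (t *: delta_mx 0 i)
        = (c * t) *: delta_mx 0 i.
      apply/rowP => j; rewrite !mxE !eqxx/= mulr1; case: eqP => _.
        by rewrite mulr1.
      by rewrite !mulr0.
    rewrite (weight_delta G_pow); last exact: K_mul.
    rewrite /= /n eqxx phi_pow//; last by have [] := sm i.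
    rewrite -(og_powM G_pow)//; last exact: K_mul.
    by rewrite mulrA mulVf ?mul1r// gt_eqF.
  have -> : upd i (c * (t *: delta_mx 0 k : 'rV[R]_l) 0 i) (t *: delta_mx 0 k)
      = t *: delta_mx 0 k.
    apply/rowP => j; rewrite !mxE eqxx/=; case: eqP => // ->.
    by rewrite eq_sym (negbTE ki) !mulr0.
  by rewrite (weight_delta G_pow)//= /n (negbTE ki).
near=> x; apply/rowP => k; rewrite !mxE.
case: eqP => [->|]; last by rewrite /n; case: eqP.
rewrite /n eqxx.
have -> : repr (germ_pow (m i) c^-1) x = repr (m i) x `^ c^-1.
  by near: x; exact: repr_germ_of.
rewrite -powRrM mulVf ?gt_eqF// powRr1//; apply: ltW.
by near: x; apply: (mg_pos M_group); have [] := sm i.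
Unshelve. all: by end_near. Qed.

Lemma mc_blowup l (m : 'I_l -> germ R) i j : (forall i, small (m i)) ->
  i != j -> lt_of le (phi (m i)) (phi (m j)) ->
  exists n, monomial_change m n (fun r => r + r 0 i *: delta_mx 0 j).
Proof.
move=> sm ij lt_ij; have [[Mi _] [Mj _]] := (sm i, sm j).
have [q [Mq miE phiq]] := M_div S Mi Mj.
have sq : small q.
  apply: (lt1_small S) => //; rewrite phiq.
  by rewrite -(lt_of_mul2l G_pow (phi (m j))) mulKVg mulg1.
pose n k := if k == i then q else m k.
exists n; apply: (mc_subst (closed_blowup_gen A_clo (ltn_ord i) (ltn_ord j) ij)) => //.
- by move=> k; rewrite /n; case: eqP.
- move=> r s /rowP rs.
  have rsi : r 0 i = s 0 i.
    by have := rs i; rewrite !mxE eqxx (negbTE ij)/= !mulr0 !addr0.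
  by apply/rowP => k; have := rs k; rewrite !mxE rsi => /addIr.
- move=> r s rs k; rewrite !mxE; apply: lerD => //.
  by apply: ler_wpM2r => //; case: (_ && _).
- move=> r Kr; apply: Krow_add => //; apply: Krow_delta; exact: Kr.
- by move=> r s; rewrite mxE scalerDl addrACA.
- move=> k t Kt; rewrite (weightD G_pow); last 2 first.
  + exact: Krow_delta.
  + by apply: Krow_delta; exact: Krow_delta.
  rewrite (weight_delta G_pow)// !mxE eqxx/=.
  have [<-|ik] := eqVneq i k.
    rewrite mulr1 (weight_delta G_pow)//= /n eqxx eq_sym (negbTE ij).
    by rewrite -(og_mul_pow G_pow)// miE (oge_mul phi_emb)// (og_mulC G_pow).
  by rewrite mulr0 scale0r (weight0 G_pow) mulg1 /= /n eq_sym (negbTE ik).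
near=> x; apply/rowP => k; rewrite !mxE.
case: eqP => [->|]; last by rewrite /n; case: eqP.
rewrite /n eqxx eq_sym (negbTE ij) miE.
have -> : repr (m j * q) x = repr (m j) x * repr q x.
  by near: x; exact: repr_mul.
by rewrite mulrC.
Unshelve. all: by end_near. Qed.

(* Two equal arguments are merged by blowing up x_i = x_j (1 + y) and setting
   y = 0. *)
Lemma reduces_merge l (m : 'I_l.+1 -> germ R) i j : (forall i, small (m i)) ->
  i != j -> m i = m j -> reduces m (m \o lift i).
Proof.
move=> sm ij mij; split=> [k|a aA]; first exact: sm.
have [j' jE] : exists j', j = lift i j'.
  by case: (unliftP i j) ij => [j' ->|->]; [exists j'|rewrite eqxx].
have qn : (l <= (ord_max : 'I_l.+1))%N by [].
have [cA hatc] := @closed_blowup_gen_std _ _ A_clo l l i ord_max j' 1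
  (ltn_ord i) qn (ltn_ord j') ltr01 _ aA.
set c := (X in germs A l X) in cA hatc.
have := germs_zero A_GQC ord_max cA; have := (fun s => hat_ins0 A_GQC ord_max s cA).
rewrite ltnn subn0 => hatb bA; set b := c \o ins ord_max 0 in hatb bA.
have bE v : b v = a (ins i (v 0 j') v).
  by rewrite /b /c /= col'_ins ins_at addr0 mulr1.
pose kappa (r : 'rV[R]_l.+1) := col' i r + r 0 i *: delta_mx 0 j'.
have {}hatb : hat A l b = push kappa (hat A l.+1 a).
  rewrite -gsubst_push; apply/funext => s; rewrite hatb hatc /gsubst.
  apply: eq_fsbigr => r _; rewrite col'_ins ins_at /gmono /kappa.
  (* At y = 0 only the constant coefficient of (1 + Y)^t survives, and it is 1. *)
  case: eqP => // _; rewrite /binom_coef rpred0 /gbinom truncn0 big_ord0.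
  by rewrite fact0 mulr1 mul1r powR1 invr1 !mulr1.
exists b => //; split.
  rewrite !germ_compE; congr germ_of; apply/funext => x; rewrite bE; congr a.
  apply/rowP => k; rewrite !mxE /=; case: unliftP => [k' ->|->] /=; first by rewrite mxE.
  by rewrite mij jE.
rewrite /Ev hatb (eval_push G_pow (g := phi \o m))//.
- by move=> k /=; apply: (small_lt1 S).
- exact: germs_K_series.
move=> r Kr; apply: (@weight_ext _ A G pow _ (phi \o m) (weight pow _ \o kappa)) => //=.
  have Kk s : Krow A s -> Krow A (kappa s).
    move=> Ks; apply: Krow_add; first by move=> k; rewrite mxE.
    by apply: Krow_delta; exact: Ks.
  move=> r' s' Kr' Ks'; rewrite -(weightD G_pow); [|exact: Kk..].
  congr weight; apply/rowP => k; rewrite !mxE mulrDl addrACA//.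
move=> k t Kt; case: (unliftP i k) => [k' ->|->].
  have -> : kappa (t *: delta_mx 0 (lift i k')) = t *: delta_mx 0 k'.
    apply/rowP => h; rewrite !mxE eqxx/= (inj_eq lift_inj).
    by rewrite (negbTE (neq_lift _ _)) mulr0 mul0r addr0.
  by rewrite (weight_delta G_pow).
have -> : kappa (t *: delta_mx 0 i) = t *: delta_mx 0 j'.
  apply/rowP => h; rewrite !mxE !eqxx/= mulr1.
  by rewrite eq_sym (negbTE (neq_lift _ _)) mulr0 add0r.
by rewrite (weight_delta G_pow)//= mij jE.
Qed.

End Reduction.

(** * Leading terms *)

Section NormalForm.
Context {R : realType} (A : fun_class R).
Context (G : groupType) (le : rel G) (pow : G -> R -> G).
Context (M : set (germ R)) (phi : germ R -> G).
Hypothesis S : setting A le pow M phi.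

Let A_GQC := set_GQC S.
Let G_pow := set_powers S.
Let A_clo := GQC_closed A_GQC.
Let A_mor := GQC_morphism A_GQC.
Local Notation small := (small M).
Local Notation reduces := (reduces A pow M phi).
Local Notation monomial_change := (monomial_change A pow M phi).

Definition row_le l : rel 'rV[R]_l := fun r s => [forall i, r 0 i <= s 0 i].

Lemma row_leP l (r s : 'rV[R]_l) : reflect (forall i, r 0 i <= s 0 i) (row_le r s).
Proof. exact: forallP. Qed.

Lemma row_le_refl l : reflexive (@row_le l).
Proof. by move=> r; apply/row_leP. Qed.

Lemma row_le_trans l : transitive (@row_le l).
Proof.
move=> s r t /row_leP rs /row_leP st; apply/row_leP => i.
exact: le_trans (rs i) (st i).
Qed.

Lemma mc_reduces l (m n : 'I_l -> germ R) tau l' (p : 'I_l' -> germ R) :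
  monomial_change m n tau -> reduces n p -> reduces m p.
Proof.
move=> mn [sp np]; split=> // a /(mc_germ mn)[b [bA [ab1 ab2] _ _]].
by have [c cA [bc1 bc2]] := np b bA; exists c => //; split; [rewrite ab1|rewrite ab2].
Qed.

Lemma phi_total m n : M m -> M n -> m != n ->
  lt_of le (phi m) (phi n) || lt_of le (phi n) (phi m).
Proof.
move=> Mm Mn mn; rewrite /lt_of eq_sym -andb_orr (og_total G_pow) ?andbT//.
by apply: contra mn => /eqP/(phi_inj S Mn Mm) ->.
Qed.

(* After ramifications making the differences r_i - s_i > 0 > r_j - s_j
   opposite, a blow-up cancels one of them. *)
Lemma cancel_coordinate l (m : 'I_l -> germ R) (r s : 'rV[R]_l) i j :
  (forall i, small (m i)) -> Krow A r -> Krow A s ->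
  s 0 i < r 0 i -> r 0 j < s 0 j ->
  (exists n tau k, [/\ monomial_change m n tau, r 0 k != s 0 k,
    tau r 0 k = tau s 0 k & forall h, r 0 h = s 0 h -> tau r 0 h = tau s 0 h]) \/
  exists l' (n : 'I_l' -> germ R), (l' < l)%N /\ reduces m n.
Proof.
move=> sm Kr Ks si sj.
have ij : i != j by apply: contraTneq si => ->; rewrite -leNgt ltW.
have ji : j != i by rewrite eq_sym.
(* The relation reads c r_i + d r_j = c s_i + d s_j. After the ramifications, adding coordinate i to
   coordinate j, or j to i, therefore makes r and s agree there; the order of the two arguments
   decides which blow-up is available. Coordinates where r and s already agree differ from i and j,
   so they are not disturbed. *)
have [||||c [d [cr dr c0 d0 cd]]] := @ramifications_ratio _ A (r 0 i - s 0 i) (s 0 j - r 0 j).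
- by apply: K_sub; [exact: Kr|exact: Ks].
- by apply: K_sub; [exact: Ks|exact: Kr].
- by rewrite subr_gt0.
- by rewrite subr_gt0.
have [n1 mc1 _] := mc_ramification S i sm cr c0.
have [n2 mc2 _] := mc_ramification S j (mc_small mc1) dr d0.
have mc12 := mc_comp mc1 mc2.
set tau := _ \o _ in mc12.
have sn2 := mc_small mc12.
have tauE u h : tau u 0 h = if h == j then d * u 0 j
    else if h == i then c * u 0 i else u 0 h.
  by rewrite /tau /= mxE [in d * _]mxE (negbTE ji) mxE.
clearbody tau.
have [nij|nij] := eqVneq (n2 i) (n2 j).
  right; case: l => [|l] in m r s i j sm Kr Ks si sj ij ji n1 mc1 n2 mc2 tau mc12 sn2 cd tauE nij *.
    by have := ltn_ord i.
  exists l, (n2 \o lift i); split=> //; apply: mc_reduces mc12 _.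
  exact: (reduces_merge S sn2 ij nij).
left; have := phi_total (sn2 i).1 (sn2 j).1 nij; case/orP => lt_n.
  have [n3 mc3] := mc_blowup S sn2 ij lt_n.
  exists n3, ((fun u : 'rV[R]_l => u + u 0 i *: delta_mx 0 j) \o tau), j; split.
  - exact: mc_comp mc12 mc3.
  - by rewrite lt_eqF.
  - rewrite /= !mxE !eqxx !mulr1 !tauE !eqxx (negbTE ij).
    move: cd; rewrite !mulrBr => cd; lra.
  move=> h rsh; rewrite /= !mxE !eqxx/= !tauE.
  have hj : h != j by apply: contraTneq sj => <-; rewrite rsh ltxx.
  have hi : h != i by apply: contraTneq si => <-; rewrite rsh ltxx.
  by rewrite (negbTE hj) (negbTE hi) rsh !mulr0.
have [n3 mc3] := mc_blowup S sn2 ji lt_n.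
exists n3, ((fun u : 'rV[R]_l => u + u 0 j *: delta_mx 0 i) \o tau), i; split.
- exact: mc_comp mc12 mc3.
- by rewrite gt_eqF.
- rewrite /= !mxE !eqxx !mulr1 !tauE !eqxx (negbTE ij).
  move: cd; rewrite !mulrBr => cd; lra.
move=> h rsh; rewrite /= !mxE !eqxx/= !tauE.
have hj : h != j by apply: contraTneq sj => <-; rewrite rsh ltxx.
have hi : h != i by apply: contraTneq si => <-; rewrite rsh ltxx.
by rewrite (negbTE hj) (negbTE hi) rsh !mulr0.
Qed.

(** Induction on the number of coordinates in which [r] and [s] differ, which [cancel_coordinate]
    strictly decreases. *)
Lemma make_comparable l (m : 'I_l -> germ R) (r s : 'rV[R]_l) :
  (forall i, small (m i)) -> Krow A r -> Krow A s ->
  (exists n tau, monomial_change m n tau /\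
    (row_le (tau r) (tau s) || row_le (tau s) (tau r))) \/
  exists l' (n : 'I_l' -> germ R), (l' < l)%N /\ reduces m n.
Proof.
have [N] := ubnP #|[pred i | r 0 i != s 0 i]|.
elim: N => // N IHN in m r s *; rewrite ltnS => rsN sm Kr Ks.
have [|/norP[]] := boolP (row_le r s || row_le s r).
  by left; exists m, id; split=> //; exact: mc_refl.
rewrite negb_forall => /existsP[i]; rewrite -ltNge => si.
rewrite negb_forall => /existsP[j]; rewrite -ltNge => sj.
have [[n [tau [k [mc rk tk th]]]]|] := cancel_coordinate sm Kr Ks si sj; last by right.
have [||||[n' [tau' [mc' cmp]]]|[l' [n' [ll' red]]]] := IHN n (tau r) (tau s).
- apply: leq_trans rsN; apply: proper_card; apply/properP; split.
    by apply/fintype.subsetP => h; rewrite !inE; apply: contra => /eqP/th ->.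
  by exists k; rewrite !inE// tk eqxx.
- exact: mc_small mc.
- exact: mc_Krow mc _ Kr.
- exact: mc_Krow mc _ Ks.
- by left; exists n', (tau' \o tau); split=> //; exact: mc_comp mc mc'.
by right; exists l', n'; split=> //; exact: mc_reduces mc red.
Qed.

(** Pairs can be treated one after the other because monotone maps preserve the comparabilities
    already obtained. *)
Lemma make_comparable_seq l (m : 'I_l -> germ R) (L : seq ('rV[R]_l * 'rV[R]_l)) :
  (forall i, small (m i)) -> (forall p, p \in L -> Krow A p.1 /\ Krow A p.2) ->
  (exists n tau, monomial_change m n tau /\ forall p, p \in L ->
    (row_le (tau p.1) (tau p.2) || row_le (tau p.2) (tau p.1))) \/
  exists l' (n : 'I_l' -> germ R), (l' < l)%N /\ reduces m n.
Proof.
move=> sm; elim: L => [|p L IHL] KL.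
  by left; exists m, id; split=> //; exact: mc_refl.
have [q qL|[n [tau [mc cmp]]]|] := IHL; last by right.
  by apply: KL; rewrite inE qL orbT.
have [K1 K2] := KL p (mem_head _ _).
have [[n' [tau' [mc' cmp']]]|[l' [n' [ll' red]]]] :=
  make_comparable (mc_small mc) (mc_Krow mc K1) (mc_Krow mc K2).
  left; exists n', (tau' \o tau); split; first exact: mc_comp mc mc'.
  move=> q; rewrite inE => /predU1P[->//|/cmp /orP[|] /row_leP qq].
    by apply/orP; left; apply/row_leP; exact: (mc_mono mc').
  by apply/orP; right; apply/row_leP; exact: (mc_mono mc').
by right; exists l', n'; split=> //; exact: mc_reduces mc red.
Qed.

Lemma gmul_gmono l (e : 'rV[R]_l) (F : gseries R l) :
  gmul (gmono e) F = fun s => F (s - e).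
Proof.
apply/funext => s; rewrite /gmul (@fsum_seq _ _ [:: e])//.
  by rewrite big_cons big_nil mem_setT addr0 /gmono eqxx mul1r.
move=> r _; rewrite inE /gmono; case: (eqVneq r e) => // _.
by rewrite mul0r eqxx.
Qed.

Lemma wo_shift (B : set R) (c : R) : wo_chain <=%R [in B] ->
  wo_chain <=%R [in [set t | B (t + c)]].
Proof.
move=> woB; apply: antisymmetric_wo_chain.
  by move=> x y _ _; exact: le_anti.
move=> D DB [x Dx].
have [||z [z1 z2] zmin] := @wo_min R B [set u | u - c \in D /\ B u] woB.
- by move=> y [].
- exists (x + c); split; first by rewrite addrK.
  by have /set_mem := DB _ Dx.
exists (z - c); split=> // y Dy; rewrite lerBlDr; apply: zmin; split.
  by rewrite addrK.
by have /set_mem := DB _ Dy.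
Qed.

Lemma wo_sub (B C : set R) : C `<=` B -> wo_chain <=%R [in B] ->
  wo_chain <=%R [in C].
Proof.
by move=> CB woB D DC; apply: woB => x /DC /set_mem /CB /mem_set.
Qed.

(** Exponents of the support are thus among those by which [closed_monomial_div] permits
    division. *)
Lemma exponent_ramification l (b : 'rV[R]_l -> R) (r : 'rV[R]_l) i :
  germs A l b -> hat A l b r != 0 -> ramifications A (r 0 i).
Proof.
move=> bA br; have r0 : 0 <= r 0 i.
  have [B BW Bb] := hat_gseries A_mor bA.
  by have [] := Bb r br i; have [_] := BW i => h /h.
have [cl|ncl] := pselect (classical A).
  by left; split=> //; apply: cl; exists l, b, r, i.
by right; split=> //; split=> //; exact: germs_Krow br _.
Qed.

Lemma divide_monomial l (b : 'rV[R]_l -> R) (e : 'rV[R]_l) : germs A l b ->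
  (forall i, ramifications A (e 0 i)) ->
  (forall s, hat A l b s != 0 -> forall i, e 0 i <= s 0 i) ->
  exists g, [/\ germs A l g, origin_eq l b (fun v => monomial_fun l e v * g v) &
    forall s, hat A l g s = hat A l b (s + e)].
Proof.
move=> bA er be; pose F : gseries R l := fun s => hat A l b (s + e).
have Fg : is_gseries l F.
  have [B BW Bb] := hat_gseries A_mor bA.
  exists (fun i => [set t | 0 <= t /\ B i (t + e 0 i)]) => [i|s Fs i].
    split; last by move=> t [].
    by apply: (wo_sub _ (wo_shift (c := e 0 i) (BW i).1)) => t [].
  have [Bi _] := Bb _ Fs i; rewrite mxE in Bi.
  split; last by rewrite leqNgt ltn_ord.
  by split=> //; have := be _ Fs i; rewrite mxE lerDr.
have bF : hat A l b = gmul (gmono e) F.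
  by rewrite gmul_gmono; apply/funext => s; rewrite /F subrK.
have [|g [gA bg gF]] := closed_monomial_div A_clo bA _ Fg bF.
  by move=> i; rewrite ltn_ord.
by exists g; split=> //; rewrite gF.
Qed.

(* As g is continuous at 0, the germ f is equivalent to c N, while c phi(N) is
   the leading term of H. *)
Definition leading_term (f : germ R) (H : G -> R) : Prop :=
  exists N c l (g : 'rV[R]_l -> R) (n : 'I_l -> germ R),
    [/\ M N, c != 0, forall i, small (n i), germs A l g & g 0 = c] /\
    [/\ f = N * germ_comp g n, H (phi N) = c &
        forall h, lt_of le (phi N) h -> H h = 0].

Lemma eval_eq0 l (F : gseries R l) (g : 'I_l -> G) : (forall r, F r = 0) ->
  hahn_eval pow F g = fun=> 0.
Proof. by move=> F0; apply/funext => h; apply: fsbig1 => r _. Qed.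

Lemma normal_form l (a : 'rV[R]_l -> R) (m : 'I_l -> germ R) :
  germs A l a -> (forall i, small (m i)) ->
  (germ_comp a m = 0 /\ Ev A pow a (phi \o m) = fun=> 0) \/ 
  leading_term (germ_comp a m) (Ev A pow a (phi \o m)).
Proof.
have [N] := ubnP l; elim: N => // N IHN in l a m *; rewrite ltnS => lN aA sm.
have [a0|/existsNP[r /eqP ar]] := pselect (forall r, hat A l a r = 0).
  left; split; last exact: eval_eq0.
  have c0 : hat A l a = hat A l (fun _ : 'rV[R]_l => 0).
    by rewrite (hat_cst A_mor)//; apply/funext => r; rewrite a0 mul0r.
  by rewrite (comp_ext S sm (hat_inj A_mor aA (germs_cst A_GQC 0 (leqnn l)) c0)).
have [B BW Bb] := hat_gseries A_mor aA.
have [||T [TP Tb]] := @finite_basis R _ _ (fun (r : 'rV[R]_l) i => r 0 i) B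
  [set r | hat A l a r != 0].
- by move=> i; have [] := BW i.
- by move=> s /Bb sB i; have [] := sB i.
have TK t : t \in T -> Krow A t by move=> /TP; exact: germs_Krow.
have [p /allpairsP[[x y] [/= xT yT ->]]|[n [tau [mc cmp]]]|[l' [n [ll' [sn red]]]]] :=
    make_comparable_seq (L := [seq (x, y) | x <- T, y <- T]) sm.
- by split=> /=; exact: TK.
- have [b [bA [ab1 ab2] bt bs]] := mc_germ mc aA; have sn := mc_small mc.
  have [t0 t0T _] := Tb r ar.
  have tot : {in T &, forall y z, row_le (tau z) (tau y) || row_le (tau y) (tau z)}.
    by move=> y z yT zT; apply: (cmp (z, y)); rewrite allpairs_f.
  (* The reversed relation turns the maximum into a least element; comparability is available on the
     images of [T] only, which is all that [seq_max] asks. *)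
  have [t tT tmin] := @seq_max _ _ (fun r s => row_le s r) tau T t0
    (@row_le_refl l) (fun y x z xy yz => row_le_trans yz xy) tot t0T.
  have b0 : hat A l b (tau t) != 0 by rewrite bt; exact: TP.
  have bmin s : hat A l b s != 0 -> forall i, tau t 0 i <= s 0 i.
    move=> /bs[u /Tb[v vT vu] ->] i.
    apply: le_trans (mc_mono mc vu i); exact/row_leP/tmin.
  have bK := germs_K_series A_GQC bA.
  have Kt : Krow A (tau t) by exact: bK.2.
  have [g [gA bg gs]] := divide_monomial bA
    (fun i => exponent_ramification i bA b0) bmin.
  right; exists (mono n (tau t)), (hat A l b (tau t)), l, g, n.
  split; first split=> //; first exact: (M_mono S sn Kt).
    by rewrite -(hat_at0 A_GQC gA) gs add0r.
  have wlt i : lt_of le ((phi \o n) i) 1%g by apply: (small_lt1 S).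
  rewrite ab1 ab2 (phi_mono S sn Kt) (comp_ext S sn bg) comp_mul comp_monomial.
  split=> //.
    (* All exponents of [b] lie above [tau t], so none but [tau t] has its weight: the leading
       coefficient receives a single term. *)
    apply: push_unique => s bs0 ws.
    by apply/esym/(weight_inj G_pow wlt Kt (bK.2 _ bs0)) => //; exact: bmin.
  move=> h; rewrite (lt_of_nle G_pow) => nh; apply/eqP; apply: contraNT nh.
  move=> /Ev_support[s bs0 <-].
  exact: (weight_le G_pow wlt Kt (bK.2 _ bs0) (bmin _ bs0)).
have [b bA [ab1 ab2]] := red a aA.
have [[b0 b0']|bl] := IHN l' b n (leq_trans ll' lN) bA sn.
  by left; rewrite ab1 ab2.
by right; rewrite ab1 ab2.
Qed.

End NormalForm.

(** * Expansions *)

Section Embedding.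
Context {R : realType} (A : fun_class R).
Context (G : groupType) (le : rel G) (pow : G -> R -> G).
Context (M : set (germ R)) (phi : germ R -> G).
Hypothesis S : setting A le pow M phi.

Let A_GQC := set_GQC S.
Let G_pow := set_powers S.
Let M_group := set_monomials S.
Local Notation small := (small M).
Local Notation leading_term := (leading_term A le M phi).
Local Notation E a m := (Ev A pow a (phi \o m)).

(* H is the product of the monomial phi(m0) and the evaluation of the series of
   a at phi(m): the product only shifts the coefficients. *)
Definition expands (f : germ R) (H : G -> R) : Prop :=
  exists l (m0 : germ R) (m : 'I_l -> germ R) (a : 'rV[R]_l -> R),
    [/\ M m0, forall i, small (m i), germs A l a, f = m0 * germ_comp a m &
        H = fun g => E a m ((phi m0)^-1 * g)%g].

Lemma expandsI l (m0 : germ R) (m : 'I_l -> germ R) (a : 'rV[R]_l -> R) :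
  M m0 -> (forall i, small (m i)) -> germs A l a ->
  expands (m0 * germ_comp a m) (fun g => E a m ((phi m0)^-1 * g)%g).
Proof. by move=> Mm0 sm aA; exists l, m0, m, a. Qed.

Lemma expands1 l (m : 'I_l -> germ R) (a : 'rV[R]_l -> R) :
  (forall i, small (m i)) -> germs A l a ->
  expands (germ_comp a m) (E a m).
Proof.
move=> sm aA; have := expandsI (mg_one M_group) sm aA; rewrite mul1r (phi1 S).
by congr expands; apply/funext => g; rewrite invg1 mul1g.
Qed.

Lemma class_germsP f : class_germs A M f <-> exists H, expands f H.
Proof.
split=> [[l [m0 [m [a [Mm0 sm aA ->]]]]]|[H [l [m0 [m [a [Mm0 sm aA fE _]]]]]]].
  by eexists; exact: expandsI.
by exists l, m0, m, a.
Qed.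

Lemma expands_shift f H q : M q -> expands f H ->
  expands (q * f) (fun g => H ((phi q)^-1 * g)%g).
Proof.
move=> Mq [l [m0 [m [a [Mm0 sm aA -> ->]]]]].
exists l, (q * m0), m, a; split=> //; rewrite ?mulrA//; first exact: mg_mul.
apply/funext => g; rewrite (oge_mul (set_phi S))//.
by rewrite invgM mulgA.
Qed.

(** Two germs are brought to the same arguments by concatenating the two tuples and adding dummy
    variables. *)
Lemma common_arguments l l' (m : 'I_l -> germ R) (m' : 'I_l' -> germ R)
    (a : 'rV[R]_l -> R) (a' : 'rV[R]_l' -> R) :
  (forall i, small (m i)) -> (forall i, small (m' i)) ->
  germs A l a -> germs A l' a' ->
  exists k (n : 'I_k -> germ R) (b b' : 'rV[R]_k -> R),
    [/\ forall i, small (n i), germs A k b, germs A k b',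
        same_germ A pow phi a m b n & same_germ A pow phi a' m' b' n].
Proof.
move=> sm sm' aA a'A.
pose n (i : 'I_(l + l')) := match fintype.split i with inl j => m j | inr j => m' j end.
have sn i : small (n i) by rewrite /n; case: (fintype.split i).
have wn i : lt_of le ((phi \o n) i) 1%g by apply: (small_lt1 S).
have nl : n \o lshift l' = m.
  by apply/funext => i; rewrite /n /= (unsplitK (inl i)).
have nr : n \o @rshift l l' = m'.
  by apply/funext => i; rewrite /n /= (unsplitK (inr i)).
exists (l + l')%N, n, (a \o pull (lshift l')), (a' \o pull (@rshift l l')); split=> //.
- by apply: (germs_rename A_GQC) aA => //; exact: lshift_inj.
- by apply: (germs_rename A_GQC) a'A => //; exact: rshift_inj.
- split; first by rewrite comp_rename nl.
  rewrite (Ev_rename A_GQC G_pow)//; last exact: lshift_inj.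
  by rewrite -[in LHS]nl.
- split; first by rewrite comp_rename nr.
  rewrite (Ev_rename A_GQC G_pow)//; last exact: rshift_inj.
  by rewrite -[in LHS]nr.
Qed.

(** A monomial [q] with [phi q] at most 1 is either 1 or small; in the second case it can serve as
    one more argument, and its coordinate function multiplies [a]. *)
Lemma expands_scale l (m : 'I_l -> germ R) (a : 'rV[R]_l -> R) q :
  (forall i, small (m i)) -> germs A l a -> M q -> le (phi q) 1%g ->
  exists k (n : 'I_k -> germ R) (b : 'rV[R]_k -> R),
    [/\ forall i, small (n i), germs A k b, q * germ_comp a m = germ_comp b n &
        E b n = fun g => E a m ((phi q)^-1 * g)%g].
Proof.
move=> sm aA Mq q1; have [q1'|q1'] := eqVneq (phi q) 1%g.
  exists l, m, a; split=> //; last first.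
    by apply/funext => g; rewrite q1' invg1 mul1g.
  rewrite (phi_inj S Mq (mg_one M_group)) ?mul1r//.
  by rewrite q1' (phi1 S).
have sq : small q by apply: (lt1_small S) => //; rewrite /lt_of q1'.
have [k [n [b [b' [sn bA b'A [ab1 ab2] [cb1 cb2]]]]]] := @common_arguments l 1 m
  (fun=> q) a (fun v => v 0 0) sm (fun=> sq) aA (germs_coord A_GQC 0 (leqnn 1)).
exists k, n, (fun v => b' v * b v); split=> //; first exact: germs_mul.
  by rewrite comp_mul -cb1 -ab1 comp_coord.
have wn i : lt_of le ((phi \o n) i) 1%g by apply: (small_lt1 S).
rewrite (Ev_mul A_GQC G_pow)// -cb2 -ab2 (Ev_coord A_GQC G_pow).
by apply/funext => g; rewrite hahn_mul_mono.
Qed.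

(** The larger of the two monomial factors is taken out; the quotient of the smaller by it is at
    most 1 and is absorbed by [expands_scale]. *)
Lemma expands_add f f' H H' : expands f H -> expands f' H' ->
  expands (f + f') (hahn_add H H').
Proof.
wlog: f f' H H' / exists l l' (m0 m0' : germ R) (m : 'I_l -> germ R)
    (m' : 'I_l' -> germ R) (a : 'rV[R]_l -> R) (a' : 'rV[R]_l' -> R),
    [/\ M m0, forall i, small (m i), germs A l a, f = m0 * germ_comp a m &
        H = fun g => E a m ((phi m0)^-1 * g)%g] /\
    [/\ M m0' /\ le (phi m0') (phi m0), forall i, small (m' i), germs A l' a',
        f' = m0' * germ_comp a' m' & H' = fun g => E a' m' ((phi m0')^-1 * g)%g].
  move=> wl ef ef'; have := ef; have := ef'.
  move=> [l' [m0' [m' [a' [Mm0' sm' aA' fE' HE']]]]].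
  move=> [l [m0 [m [a [Mm0 sm aA fE HE]]]]].
  have /orP[le0|le0] := og_total G_pow (phi m0') (phi m0).
    by apply: wl => //; exists l, l', m0, m0', m, m', a, a'.
  rewrite addrC (_ : hahn_add H H' = hahn_add H' H); last first.
    by apply/funext => g; exact: addrC.
  by apply: wl => //; exists l', l, m0', m0, m', m, a', a.
move=> [l [l' [m0 [m0' [m [m' [a [a' [[Mm0 sm aA -> ->]]]]]]]]]].
move=> [[Mm0' le0] sm' a'A -> ->] _ _.
have [q [Mq m0E phiq]] := M_div S Mm0' Mm0.
have q1 : le (phi q) 1%g.
  by rewrite phiq -(og_le_mul2l G_pow (phi m0)) mulKVg mulg1.
have [k' [n' [b' [sn' b'A cb' Eb']]]] := expands_scale sm' a'A Mq q1.
have [k [n [c [c' [sn cA c'A [ac1 ac2] [bc1 bc2]]]]]] :=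
  common_arguments sm sn' aA b'A.
have wn i : lt_of le ((phi \o n) i) 1%g by apply: (small_lt1 S).
exists k, m0, n, (fun v => c v + c' v); split=> //; first exact: germs_add.
  by rewrite comp_add mulrDr -ac1 -bc1 -cb' m0E mulrA.
apply/funext => g; rewrite (Ev_add A_GQC G_pow)// -ac2 -bc2 Eb' /hahn_add.
by rewrite phiq invgM invgK mulgA mulgK.
Qed.

Lemma expands_mul f f' H H' : expands f H -> expands f' H' ->
  expands (f * f') (hahn_mul H H').
Proof.
move=> [l [m0 [m [a [Mm0 sm aA -> ->]]]]] [l' [m0' [m' [a' [Mm0' sm' a'A -> ->]]]]].
have [k [n [c [c' [sn cA c'A [ac1 ac2] [bc1 bc2]]]]]] := common_arguments sm sm' aA a'A.
have wn i : lt_of le ((phi \o n) i) 1%g by apply: (small_lt1 S).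
exists k, (m0 * m0'), n, (fun v => c v * c' v); split=> //.
- exact: mg_mul.
- exact: germs_mul.
- by rewrite comp_mul mulrACA -ac1 -bc1.
apply/funext => g; rewrite (Ev_mul A_GQC G_pow)// -ac2 -bc2 (oge_mul (set_phi S))//.
(* Translating the summation index by [phi m0] collects the two shifts into one by
   [phi m0 * phi m0']. *)
rewrite /hahn_mul (@reindex_fsbig _ _ _ _ _ (fun h => phi m0 * h)%g setT)//.
  apply: eq_fsbigr => h _; rewrite mulKg.
  have -> : ((phi m0')^-1 * ((phi m0 * h)^-1 * g) =
             h^-1 * ((phi m0 * phi m0')^-1 * g))%g.
    rewrite !invgM -!mulgA !(mulgA (phi m0')^-1%g h^-1%g).
    by rewrite (og_mulC G_pow _ h^-1%g) !mulgA.
  by [].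
split=> // [x y _ _ /mulgI//|h _]; exists ((phi m0)^-1 * h)%g => //.
by rewrite mulKVg.
Qed.

Lemma expands_opp f H : expands f H -> expands (- f) (fun g => - H g).
Proof.
move=> [l [m0 [m [a [Mm0 sm aA -> ->]]]]].
have wm i : lt_of le ((phi \o m) i) 1%g by apply: (small_lt1 S).
have cA := germs_cst A_GQC (-1) (leqnn l).
exists l, m0, m, (fun v => -1 * a v); split=> //; first exact: germs_mul.
  rewrite comp_mul comp_cst -mulrN; congr (_ * _).
  have -> : germ_cst (-1 : R) = - 1 by apply/esym; rewrite germ_of_oppE.
  by rewrite mulN1r.
apply/funext => g; rewrite (Ev_mul A_GQC G_pow)// (Ev_cst A_GQC G_pow).
rewrite /hahn_mul (@fsum_seq _ _ [:: 1%g])//.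
  rewrite big_cons big_nil mem_setT addr0 /hahn_mono eqxx mulr1 invg1 mul1g.
  by rewrite mulN1r.
move=> h _; rewrite inE /hahn_mono; case: (eqVneq h 1%g) => // _.
by rewrite mulr0 mul0r eqxx.
Qed.

Lemma expands_lead f H : expands f H ->
  (f = 0 /\ H = fun=> 0) \/ leading_term f H.
Proof.
move=> [l [m0 [m [a [Mm0 sm aA -> ->]]]]].
have [[-> ->]|] := normal_form S aA sm; first by left; rewrite mulr0.
move=> [N [c [l' [g [n [[MN c0 sn gA gc] [-> Ec Eh]]]]]]]; right.
exists (m0 * N), c, l', g, n; rewrite (oge_mul (set_phi S))//; split; split=> //.
- exact: mg_mul.
- by rewrite mulrA.
- by rewrite mulKg.
move=> h hN; apply: Eh; rewrite -(lt_of_mul2l G_pow (phi m0)).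
by rewrite mulKVg.
Qed.

Lemma leading_sim (f : germ R) H : leading_term f H -> exists N c,
  [/\ M N, c != 0, H (phi N) = c, forall h, lt_of le (phi N) h -> H h = 0 &
      repr f x / repr N x @[x --> +oo] --> c].
Proof.
move=> [N [c [l' [g [n [[MN c0 sn gA gc] [-> Hc Hh]]]]]]]; exists N, c; split=> //.
have := comp_cvg S sn gA; rewrite gc; apply: cvg_trans; apply: near_eq_cvg.
near=> x; have -> : repr (N * germ_comp g n) x = repr N x * repr (germ_comp g n) x.
  by near: x; exact: repr_mul.
rewrite mulrC mulKf// gt_eqF//; near: x; exact: (mg_pos M_group).
Unshelve. all: by end_near. Qed.

Lemma cvg_sign (f N : germ R) c : M N -> repr f x / repr N x @[x --> +oo] --> (c : R) ->
  0 < c -> \forall x \near +oo, 0 < repr f x.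
Proof.
move=> MN fc c0; near=> x; have N0 : 0 < repr N x.
  by near: x; exact: (mg_pos M_group).
have : 0 < repr f x / repr N x by near: x; exact: (cvgr_gt _ fc).
by rewrite pmulr_lgt0// invr_gt0.
Unshelve. all: by end_near. Qed.

(** The same [c] is the limit of f / N and the leading coefficient of [H], so its sign decides both.
    This is what makes the embedding increasing. *)
Lemma leading_sign (f : germ R) H : leading_term f H ->
  (hahn_pos le H /\ \forall x \near +oo, 0 < repr f x) \/
  (hahn_pos le (fun g => - H g) /\ \forall x \near +oo, repr f x < 0).
Proof.
move=> /leading_sim[N [c [MN c0 Hc Hh fc]]]; have [cp|cn|c0'] := ltgtP 0 c.
- left; split; last exact: cvg_sign fc cp.
  by exists (phi N); rewrite ?Hc.
- right; split; first by exists (phi N); rewrite ?Hc ?oppr_gt0// => h /Hh ->; rewrite oppr0.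
  have : repr (- f) x / repr N x @[x --> +oo] --> - c.
    apply: cvg_trans (cvgN fc); apply: near_eq_cvg.
    by apply: filterS (repr_opp f) => x ->; rewrite mulNr.
  move=> /(cvg_sign MN)/(_ _)/[dup]; rewrite oppr_gt0 => /(_ cn) h _.
  apply: filterS2 (repr_opp f) h => x ->; by rewrite oppr_gt0.
- by rewrite -c0' eqxx in c0.
Qed.

Lemma leading_germ_neq0 f H : leading_term f H -> f != 0.
Proof.
move=> lf; apply/eqP => f0; have r0 := @repr_0 R; rewrite -f0 in r0.
suff /filter_ex[x []] : \forall x \near +oo, repr f x = 0 /\ repr f x != 0.
  by move=> ->; rewrite eqxx.
have [[_ h]|[_ h]] := leading_sign lf; apply: filterS2 r0 h => x fx.
  by rewrite fx ltxx.
by rewrite fx ltxx.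
Qed.

(** The difference of two expansions of [f] expands 0, and a germ with a leading term is not 0, so
    the difference has none and vanishes. *)
Lemma expands_unique f H H' : expands f H -> expands f H' -> H = H'.
Proof.
move=> fH fH'; have := expands_add fH (expands_opp fH'); rewrite subrr.
move=> /expands_lead[[_ HH']|/leading_germ_neq0]; last by rewrite eqxx.
apply/funext => g; apply/eqP; rewrite -subr_eq0; apply/eqP.
by have := congr1 (@^~ g) HH'.
Qed.

Definition Phi (f : germ R) : G -> R := xget (fun=> 0) [set H | expands f H].

Lemma PhiE f H : expands f H -> Phi f = H.
Proof.
by move=> fH; apply: xget_unique => // H' fH'; exact: expands_unique fH' fH.
Qed.

Lemma expands_Phi f : class_germs A M f -> expands f (Phi f).
Proof. by move=> /class_germsP[H fH]; rewrite (PhiE fH). Qed.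

End Embedding.

(** * The ordered field of germs *)

Section OrderedField.
Context {R : realType} (A : fun_class R).
Context (G : groupType) (le : rel G) (pow : G -> R -> G).
Context (M : set (germ R)) (phi : germ R -> G).
Hypothesis S : setting A le pow M phi.

Let A_GQC := set_GQC S.
Let G_pow := set_powers S.
Let M_group := set_monomials S.
Let A_clo := GQC_closed A_GQC.
Local Notation small := (small M).
Local Notation F := (class_germs A M).
Local Notation Phi := (Phi A pow M phi).
Local Notation expands := (expands A pow M phi).

Lemma expands_F f H : expands f H -> F f.
Proof. by move=> fH; apply/(class_germsP A pow M phi); exists H. Qed.

Lemma expands_monomial m : M m -> expands m (hahn_mono (phi m)).
Proof.
move=> Mm; have m0 (i : 'I_0) : small 0 by case: i.
have := expandsI pow phi Mm m0 (germs_cst A_GQC 1 (leqnn 0)).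
rewrite comp_cst mulr1; congr expands; apply/funext => g.
rewrite (Ev_cst A_GQC G_pow) mul1r /hahn_mono; congr ((nat_of_bool _)%:R).
by rewrite -(inj_eq (mulgI (phi m))) mulKVg mulg1.
Qed.

(** The inverse is obtained from the implicit equation g(v) (1/g(0) + y) = 1 in an additional
    standard variable y. The shift by 1/g(0) makes y = 0 a solution at the origin, and the
    derivative in y there is g(0). *)
Lemma germs_inv l (g : 'rV[R]_l -> R) : germs A l g -> g 0 != 0 ->
  exists2 h, germs A l h & origin_eq l (fun v => g v * h v) (fun=> 1).
Proof.
move=> gA g0; pose i : 'I_l.+1 := ord_max.
have ml : (l <= l.+1)%N by [].
pose f (w : 'rV[R]_l.+1) := (g \o pull (lift i)) w * ((g 0)^-1 + w 0 i) + -1.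
have fA : germs A l f.
  apply: germs_add => //; last exact: germs_cst.
  apply: germs_mul => //; last by apply: germs_add => //; [exact: germs_cst|exact: germs_coord].
  apply: (germs_rename A_GQC) gA => //; first exact: lift_inj.
  by move=> k kl; rewrite lift_max.
have pull0 (t : R) : pull (lift i) (t *: delta_mx 0 i) = 0.
  by apply/rowP => k; rewrite !mxE eqxx/= eq_sym (negbTE (neq_lift _ _)) mulr0.
(* Along the y-axis [f] is linear, so the difference quotient defining the derivative is
   constant. *)
have fE t : f (t *: delta_mx 0 i) = g 0 * t.
  rewrite /f /= pull0 !mxE !eqxx/= mulr1 mulrDr mulfV//.
  by rewrite addrAC subrr add0r.
have f0 : f 0 = 0 by rewrite -(scale0r (delta_mx 0 i)) fE mulr0.
have df : 'D_(delta_mx 0 i) f 0 = g 0.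
  apply/cvg_lim => //; apply: cvg_near_cst.
  near=> t; have t0 : t != 0 by near: t; exact: nbhs_dnbhs_neq.
  by rewrite /= f0 subr0 addr0 fE /GRing.scale/= mulrCA mulVf// mulr1.
have [|y [yA y0 yf _]] := closed_implicit A_clo (leqnn l : (l <= i)%N) fA f0.
  by rewrite df.
exists (fun v => (g 0)^-1 + y v).
  by apply: germs_add => //; exact: germs_cst.
have [r r0 yr] := yf; exists r => // v /yr.
rewrite /f /= ins_at => /eqP; rewrite subr_eq0 => /eqP <-.
congr (g _ * _); apply/rowP => k; by rewrite mxE ins_lift.
Unshelve. all: by end_near. Qed.

Lemma expands_sub f f' : F f -> F f' ->
  expands (f - f') (fun g => Phi f g - Phi f' g).
Proof.
move=> Ff Ff'; apply: (expands_add S (expands_Phi S Ff)).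
exact: (expands_opp S (expands_Phi S Ff')).
Qed.

Lemma class_germs_field : is_ordered_field F.
Proof.
split=> [|f g Ff Fg|f g Ff Fg|f Ff f0|f g Ff Fg].
- exact: expands_F (expands_monomial (mg_one M_group)).
- exact: expands_F (expands_sub Ff Fg).
- exact: expands_F (expands_mul S (expands_Phi S Ff) (expands_Phi S Fg)).
- have [[fE _]|] := expands_lead S (expands_Phi S Ff).
    by rewrite fE eqxx in f0.
  (* In f = N g(n) both factors are invertible: N in the group of monomials, and g because g(0) is
     nonzero. *)
  move=> [N [c [l [g [n [[MN c0 sn gA gc] [fE _ _]]]]]]].
  rewrite -gc in c0; have [h hA gh] := germs_inv gA c0.
  have [N' MN' NN'] := mg_inv M_group MN.
  exists (N' * germ_comp h n).
    exact: expands_F (expandsI pow phi MN' sn hA).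
  by rewrite fE mulrACA NN' mul1r -comp_mul (comp_ext S sn gh) comp_cst.
have [[fg _]|lead] := expands_lead S (expands_sub Ff Fg).
  by left; rewrite (subr0_eq fg); exact: germ_le_refl.
have [[_ h]|[_ h]] := leading_sign S lead; [right|left].
  apply: filterS2 (repr_sub f g) h => x ->.
  by rewrite subr_gt0 => /ltW.
apply: filterS2 (repr_sub f g) h => x ->.
by rewrite subr_lt0 => /ltW.
Qed.

Lemma hahn_pos_asym (H : G -> R) :
  hahn_pos le H -> hahn_pos le (fun g => - H g) -> False.
Proof.
move=> [g g0 gH] [h h0 hH]; rewrite oppr_gt0 in h0.
have [gh|] := boolP (lt_of le g h); first by rewrite gH// ltxx in h0.
rewrite (lt_of_nle G_pow) negbK => hg.
have [hg'|] := eqVneq h g; first by rewrite hg' ltNge ltW in h0.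
move=> nhg; have : lt_of le h g by rewrite /lt_of nhg.
by move=> /hH /eqP; rewrite oppr_eq0 => /eqP g0'; rewrite g0' ltxx in g0.
Qed.

Lemma Phi_embedding : ordered_field_embedding le F Phi.
Proof.
split=> [f Ff||f g Ff Fg|f g Ff Fg|f g Ff Fg].
- have [l [m0 [m [a [Mm0 sm aA _ ->]]]]] := expands_Phi S Ff.
  have := K_series_hahn G_pow (fun i => small_lt1 S (sm i)) (germs_K_series A_GQC aA).
  move=> hE; apply: antisymmetric_wo_chain.
    move=> x y _ _ /andP[xy yx]; apply: (og_anti G_pow); by rewrite xy yx.
  move=> D Dsub [x Dx].
  have [||z [[z1 z2] _]] := hE [pred g | (phi m0 * g)%g \in D].
  - by move=> g /Dsub; rewrite inE mulKg.
  - by exists ((phi m0)^-1 * x)%g; rewrite inE mulKVg.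
  exists (phi m0 * z)%g; split=> // y Dy.
  rewrite -(og_le_mul2l G_pow (phi m0)^-1%g) mulKg; apply: z2.
  by rewrite inE mulKVg.
- by rewrite (PhiE S (expands_monomial (mg_one M_group))) (phi1 S).
- exact: (PhiE S (expands_add S (expands_Phi S Ff) (expands_Phi S Fg))).
- exact: (PhiE S (expands_mul S (expands_Phi S Ff) (expands_Phi S Fg))).
have [[fg HH]|lead] := expands_lead S (expands_sub Fg Ff).
  rewrite (subr0_eq fg); split=> _; first exact: germ_le_refl.
  by left.
have [[Hp h]|[Hn h]] := leading_sign S lead.
  split=> _; last by right.
  by apply: filterS2 (repr_sub g f) h => x ->; rewrite subr_gt0 => /ltW.
split.
  move=> [Hfg|Hp]; last by have := hahn_pos_asym Hp Hn.
  case: Hn => k; have := congr1 (@^~ k) Hfg => /= ->.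
  by rewrite subrr oppr0 ltxx.
move=> fg; suff /filter_ex[x [fgx]] : \forall x \near +oo,
    repr f x <= repr g x /\ repr g x - repr f x < 0.
  by rewrite subr_lt0 ltNge fgx.
near=> x; split; first by near: x; exact: fg.
have <- : repr (g - f) x = repr g x - repr f x by near: x; exact: repr_sub.
by near: x; exact: h.
Unshelve. all: by end_near. Qed.

End OrderedField.

(** * Truncations *)

Section Truncation.
Context {R : realType} (A : fun_class R).
Context (G : groupType) (le : rel G) (pow : G -> R -> G).
Context (M : set (germ R)) (phi : germ R -> G).
Hypothesis S : setting A le pow M phi.

Let A_GQC := set_GQC S.
Let G_pow := set_powers S.
Let M_group := set_monomials S.
Let K := exponent_field A.
Local Notation small := (small M).
Local Notation Phi := (Phi A pow M phi).
Local Notation expands := (expands A pow M phi).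
Local Notation E a m := (Ev A pow a (phi \o m)).

(** With [P] the test of being above the cutting point, a truncated evaluation is the evaluation of
    a subseries. *)
Lemma push_restrict (X : choiceType) (w : X -> G) (P : pred G) (u v : X -> R) :
  (forall x, P (w x) -> v x = u x) -> (forall x, ~~ P (w x) -> v x = 0) ->
  push w v = fun k => if P k then push w u k else 0.
Proof.
move=> vu v0; apply/funext => k; rewrite /push; case: ifPn => Pk.
  by apply: eq_fsbigr => x /set_mem /= wx; rewrite vu ?wx.
by apply: fsbig1 => x /= wx; rewrite v0 ?wx.
Qed.

Lemma gseries_convergent_sub l (U V : gseries R l) : gseries_convergent U ->
  (forall r, V r = U r \/ V r = 0) -> gseries_convergent V.
Proof.
move=> [[B BW Bb] [rho rho0 sU]] VU; split.
  by exists B => // r; have [->|->] := VU r; [exact: Bb|rewrite eqxx].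
exists rho => //; rewrite /summable; apply: le_lt_trans sU.
apply: le_esum => r _; have [->//|->] := VU r.
by rewrite mul0r abse0 abse_ge0.
Qed.

Lemma truncate_an_star l (a : 'rV[R]_l -> R) (m : 'I_l -> germ R) g :
  is_an_star A -> germs A l a -> (forall i, small (m i)) ->
  exists f, expands f (hahn_trunc le g (E a m)).
Proof.
move=> A_an aA sm; pose w := weight pow (phi \o m).
pose V : gseries R l := fun r => if lt_of le g (w r) then hat A l a r else 0.
have [aconv _] := (A_an l a (hat A l a)).1 (conj aA erefl).
have Vconv : gseries_convergent V.
  by apply: gseries_convergent_sub aconv _ => r; rewrite /V; case: ifP; [left|right].
(* Here [is_an_star] is read from right to left: a convergent series is the series of the germ of
   its sum. *)
have [|bA bV] := (A_an l (gseries_sum V) V).2.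
  by split=> //; exists (const_mx 1) => // i; rewrite mxE.
exists (germ_comp (gseries_sum V) m).
have := expands1 S sm bA; congr expands; rewrite /Ev bV.
by apply: push_restrict => r; rewrite /V => wr; rewrite ?wr ?(negbTE wr).
Qed.

Lemma expands0 : expands 0 (fun=> 0).
Proof.
have h1 := expands_monomial S (mg_one M_group).
have := expands_add S h1 (expands_opp S h1); rewrite subrr.
by congr expands; apply/funext => g; rewrite /hahn_add subrr.
Qed.

Lemma hahn_trunc_add g (H H' : G -> R) :
  hahn_trunc le g (hahn_add H H') = hahn_add (hahn_trunc le g H) (hahn_trunc le g H').
Proof.
by apply/funext => k; rewrite /hahn_trunc /hahn_add; case: ifP => // _; rewrite addr0.
Qed.

Lemma hahn_trunc_shift q g (H : G -> R) :
  hahn_trunc le g (fun k => H (q^-1 * k)%g) =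
  fun k => hahn_trunc le (q^-1 * g)%g H (q^-1 * k)%g.
Proof. by apply/funext => k; rewrite /hahn_trunc (lt_of_mul2l G_pow). Qed.

Lemma eval_ins l (a : 'rV[R]_l.+1 -> R) (e : 'rV[R]_l -> R)
    (g : 'I_l.+1 -> G) rho : (forall i, lt_of le (g i) 1%g) ->
  germs A l.+1 a -> germs A l e ->
  (forall r, hat A l.+1 a r != 0 -> r 0 ord0 = rho) ->
  (forall s, hat A l e s = hat A l.+1 a (ins ord0 rho s)) ->
  Ev A pow a g = fun k => Ev A pow e (g \o lift ord0) ((pow (g ord0) rho)^-1 * k)%g.
Proof.
move=> g1 aA eA ar ea; have [_ eK] := germs_K_series A_GQC eA.
have fib z := K_series_fiber G_pow z (fun i => g1 (lift ord0 i)) (germs_K_series A_GQC eA).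
have wE s : weight pow g (ins ord0 rho s) =
    (pow (g ord0) rho * weight pow (g \o lift ord0) s)%g.
  rewrite /weight big_ord_recl ins_at; congr (_ * _)%g.
  by apply: eq_bigr => i _; rewrite ins_lift.
have inj : injective (ins ord0 rho : 'rV[R]_l -> _).
  by move=> s t st; rewrite -(col'_ins ord0 rho s) st col'_ins.
have aE : hat A l.+1 a = push (ins ord0 rho) (hat A l e).
  apply/funext => r; have [a0|ar0] := eqVneq (hat A l.+1 a r) 0.
    apply/esym/eqP; rewrite a0; apply: contraPT a0 => p0.
    have [s es <-] := push_neq0 p0.
    by move/eqP; rewrite -ea (negbTE es).
  have rE := ins_col' (ar r ar0); by rewrite -rE push_inj// ea.
apply/funext => k; rewrite /Ev !hahn_evalE aE push_comp => [|z].
  apply: eq_fsbigl; apply/seteqP; split=> s /=; rewrite wE.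
    by move=> <-; rewrite mulKg.
  by move=> ->; rewrite mulKVg.
apply: sub_finite_set (fib ((pow (g ord0) rho)^-1 * z)%g) => s /= [es <-].
by split=> //; rewrite wE mulKg.
Qed.

Hypothesis A_nat : natural_class A.
Hypothesis A_trunc : truncation_closed_class A.

Definition truncatable l (m : 'I_l -> germ R) : Prop := forall a g, germs A l a ->
  exists f, expands f (hahn_trunc le g (E a m)).

Lemma ramifications0 : ramifications A 0.
Proof.
have [cl|ncl] := pselect (classical A); first by left; split=> //; exact: rpred0.
by right; split=> //; split=> //; exact: K0.
Qed.

(* Here a is x_0^rho times a germ in one variable less. *)
Lemma truncate_homogeneous l (m : 'I_l.+1 -> germ R) (a : 'rV[R]_l.+1 -> R) g rho :
  (forall i, small (m i)) -> truncatable (m \o lift ord0) -> germs A l.+1 a ->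
  (forall r, hat A l.+1 a r != 0 -> r 0 ord0 = rho) ->
  exists f, expands f (hahn_trunc le g (E a m)).
Proof.
move=> sm IH aA ar.
have [a0|/existsNP[r /eqP r0]] := pselect (forall r, hat A l.+1 a r = 0).
  exists 0; rewrite (_ : hahn_trunc _ _ _ = fun=> 0); first exact: expands0.
  by apply/funext => k; rewrite /hahn_trunc /Ev eval_eq0// if_same.
have rhoE := ar r r0; have Krho : K rho by rewrite -rhoE; exact: (germs_Krow aA r0).
pose e : 'rV[R]_l.+1 := rho *: delta_mx 0 ord0.
have [||h [hA _ ha]] := divide_monomial S aA (e := e).
- move=> i; rewrite !mxE eqxx/=; case: eqP => _.
    by rewrite mulr1 -rhoE; exact: (exponent_ramification S _ aA r0).
  by rewrite mulr0; exact: ramifications0.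
- move=> s s0 i; rewrite !mxE eqxx/=; case: eqP => [->|_].
    by rewrite mulr1 (ar s s0).
  rewrite mulr0; have [B BW Bb] := hat_gseries (GQC_morphism A_GQC) aA.
  by have [Bs _] := Bb s s0 i; exact: (BW i).2.
(* After division by x_0^rho the series no longer involves X_0, so setting x_0 = 0 loses no
   coefficient. *)
have := germs_zero A_GQC ord0 hA; rewrite ?ltn0Sn subn1 /= => bA.
have bh := fun s => hat_ins0 A_GQC ord0 s hA.
have ba s : hat A l (h \o ins ord0 0) s = hat A l.+1 a (ins ord0 rho s).
  have := bh s; rewrite ?ltn0Sn subn1 /= => ->; rewrite ha; congr (hat _ _ _ _).
  apply/rowP => k; rewrite !mxE eqxx/=; case: unliftP => [j ->|->] /=.
    by rewrite mulr0 addr0.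
  by rewrite mulr1 add0r.
rewrite (eval_ins (fun i => small_lt1 S (sm i)) aA bA ar ba) hahn_trunc_shift.
have [f fE] := IH _ ((pow (phi (m ord0)) rho)^-1 * g)%g bA.
exists (germ_pow (m ord0) rho * f).
have [Mm _] := sm ord0; have := expands_shift S (set_M_pow S Mm Krho) fE.
by rewrite (set_phi_pow S Mm Krho).
Qed.

(** The largest exponent [rho] of x_0 is peeled off: with [b] the truncation of [a] strictly below
    [rho], a - b involves x_0 with exponent [rho] only, and [b] involves fewer values. Truncation of
    Hahn series is additive, so the two results add up. *)
Lemma truncate_finite l (m : 'I_l.+1 -> germ R) (a : 'rV[R]_l.+1 -> R) g (V : seq R) :
  (forall i, small (m i)) -> truncatable (m \o lift ord0) -> germs A l.+1 a ->
  (forall v, v \in V -> 0 <= v) ->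
  (forall r, hat A l.+1 a r != 0 -> r 0 ord0 \in V) ->
  exists f, expands f (hahn_trunc le g (E a m)).
Proof.
move=> sm IH; have [N] := ubnP (size V); elim: N => // N IHN in V a *.
rewrite ltnS => VN aA V0 aV; have [[v vV]|nV] := pselect (exists v, v \in V); last first.
  (* Without any admissible value the series is 0, and the condition on its exponents holds
     vacuously for any [rho]. *)
  apply: (truncate_homogeneous _ sm IH aA (rho := 0)) => r /aV rV.
  by case: nV; exists (r 0 ord0).
have tot : {in V &, forall y z : R, (y <= z) || (z <= y)}.
  by move=> y z _ _; exact: le_total.
have [rho rhoV rhomax] := seq_max lexx le_trans tot vV.
have [b bA ba] := A_trunc aA (V0 _ rhoV).
pose c v := a v + (-1) * b v.
have nA : germs A l.+1 (fun v => -1 * b v).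
  by apply: germs_mul => //; exact: germs_cst.
have cA : germs A l.+1 c by exact: germs_add.
have hc r : hat A l.+1 c r = hat A l.+1 a r - hat A l.+1 b r.
  rewrite (hat_add (GQC_morphism A_GQC) aA nA).
  rewrite (hat_mul (GQC_morphism A_GQC) (germs_cst A_GQC (-1) (leqnn _)) bA).
  rewrite (hat_cst (GQC_morphism A_GQC))//; congr (_ + _).
  rewrite /gmul (@fsum_seq _ _ [:: 0])//.
    by rewrite big_cons big_nil mem_setT /gmono eqxx mulr1 mulN1r subr0 addr0.
  move=> s _; rewrite inE /gmono; case: (eqVneq s 0) => // _.
  by rewrite mulr0 mul0r eqxx.
have wm i : lt_of le ((phi \o m) i) 1%g by apply: (small_lt1 S).
have aE : E a m = hahn_add (E c m) (E b m).
  rewrite -(Ev_add A_GQC G_pow)//; congr (Ev _ _ _ _).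
  by apply/funext => u; rewrite /c mulN1r subrK.
rewrite aE hahn_trunc_add.
have [|f1 f1E] := truncate_homogeneous (rho := rho) g sm IH cA.
  move=> r; rewrite hc ba; case: ltP => [|rho_r]; first by rewrite subrr eqxx.
  rewrite subr0 => /aV rV; apply/eqP; rewrite eq_le rho_r andbT; exact: rhomax.
have [||||f2 f2E] := IHN [seq v <- V | v < rho] b.
- apply: leq_trans VN; rewrite size_filter ltn_neqAle count_size andbT.
  rewrite -all_count; apply/allPn; exists rho => //; by rewrite ltxx.
- exact: bA.
- by move=> u; rewrite mem_filter => /andP[_ /V0].
- move=> r; rewrite ba; case: ifP => [lt_r /aV rV|]; last by rewrite eqxx.
  by rewrite mem_filter lt_r.
by exists (f1 + f2); exact: (expands_add S).
Qed.

Lemma og_pow_le (g h : G) t : K t -> 0 <= t -> le g h -> le (pow g t) (pow h t).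
Proof.
move=> Kt t0 gh; have : le (pow (g * h^-1)%g t) 1%g.
  apply: (og_pow_le1 G_pow) => //; rewrite (og_mulC G_pow).
  by rewrite -(og_le_mul2l G_pow h) mulKVg mulg1.
rewrite (og_mul_pow G_pow)// (og_pow_inv G_pow)// (og_mulC G_pow).
by rewrite -(og_le_mul2l G_pow (pow h t)) mulKVg mulg1.
Qed.

Lemma truncate_natural l (m : 'I_l -> germ R) : (forall i, small (m i)) ->
  truncatable m.
Proof.
elim: l m => [|l IHl] m sm a g aA.
  have [g1|g1] := boolP (lt_of le g 1%g).
    exists (germ_comp a m); rewrite (_ : hahn_trunc _ _ _ = E a m); first exact: (expands1 S).
    apply/funext => k; rewrite /hahn_trunc; case: ifPn => // gk.
    apply/esym/eqP; apply: contraNT gk => /Ev_support[r _ <-].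
    by rewrite /weight big_ord0.
  exists 0; rewrite (_ : hahn_trunc _ _ _ = fun=> 0); first exact: expands0.
  apply/funext => k; rewrite /hahn_trunc; case: ifPn => // gk.
  apply/eqP; apply: contraNT g1 => /Ev_support[r _ wr].
  by move: gk; rewrite -wr /weight big_ord0.
have wm i : lt_of le ((phi \o m) i) 1%g by apply: (small_lt1 S).
(* Either all weights exceed [g] and nothing is cut, or an exponent [r] of weight at most [g]
   provides the bound [alpha]. *)
have [all|] := pselect (forall r, hat A l.+1 a r != 0 -> lt_of le g (weight pow (phi \o m) r)).
  exists (germ_comp a m); rewrite (_ : hahn_trunc _ _ _ = E a m); first exact: (expands1 S).
  apply/funext => k; rewrite /hahn_trunc; case: ifPn => // gk.
  by apply/esym/eqP; apply: contraNT gk => /Ev_support[r /all + <-].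
move=> /existsNP[r /not_implyP[ar /negP]]; rewrite (lt_of_nle G_pow) negbK => wr.
have [_ aK] := germs_K_series A_GQC aA.
have [B BW Bb] := hat_gseries (GQC_morphism A_GQC) aA.
have pos s i : hat A l.+1 a s != 0 -> 0 <= s 0 i.
  by move=> s0; have [Bs _] := Bb s s0 i; exact: (BW i).2.
have tot : {in enum 'I_l.+1 &, forall i j,
    le (phi (m j)) (phi (m i)) || le (phi (m i)) (phi (m j))}.
  by move=> i j _ _; exact: (og_total G_pow).
have [b _ bmin] := @seq_max _ _ (fun x y => le y x) (phi \o m) (enum 'I_l.+1) ord0
  (og_refl G_pow) (fun y x z xy yz => og_trans G_pow yz xy) tot (mem_enum _ _).
(* As phi(m_b) is the smallest phi(m_i), an exponent s with s_b >= alpha has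
   weight at most phi(m_b)^alpha <= weight r <= g. *)
pose alpha := \sum_(i < l.+1) r 0 i.
have [Kalpha alpha0 wb] : [/\ K alpha, 0 <= alpha &
    le (pow (phi (m b)) alpha) (weight pow (phi \o m) r)].
  rewrite /alpha /weight; elim/big_rec2: _ => [|i x y _ [Ky y0 xy]].
    by split=> //; [exact: K0|rewrite (og_pow0 G_pow) (og_refl G_pow)].
  have Ki := aK r ar i; have ri := pos r i ar; split.
  - exact: K_add.
  - exact: addr_ge0.
  rewrite (og_powD G_pow)//; apply: (og_trans G_pow) (_ : le (pow (phi (m i)) (r 0 i) * pow (phi (m b)) y)%g _).
    rewrite ![(_ * pow (phi (m b)) y)%g](og_mulC G_pow) (og_le_mul2l G_pow).
    by apply: og_pow_le => //; apply: bmin; rewrite mem_enum.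
  by rewrite (og_le_mul2l G_pow).
(* [A_trunc] cuts with respect to the variable of index 0 only, so the argument [m b] is moved there
   by a transposition. *)
pose p : 'I_l.+1 -> 'I_l.+1 := tperm ord0 b.
have pinj : injective p by exact: perm_inj.
pose n := m \o p.
have sn i : small (n i) by exact: sm.
have wn i : lt_of le ((phi \o n) i) 1%g by exact: wm.
have mE : m = n \o p by apply/funext => i; rewrite /n /= /p tpermK.
have cA : germs A l.+1 (a \o pull p) by apply: (germs_rename A_GQC) aA.
rewrite [in E a m]mE -(Ev_rename A_GQC G_pow (g := phi \o n) pinj wn aA).
set c := a \o pull p in cA *.
have [d dA dc] := A_trunc cA alpha0.
have [D Dfin Dd] := A_nat dA.
have finV : finite_set (D ord0 `&` [set t | t < alpha]) by have [_] := Dfin ord0.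
have [_ cK] := germs_K_series A_GQC cA.
(* Passing from [c] to [d] removes only exponents whose weight is at most [g], which the truncation
   discards anyway; naturality leaves [d] finitely many exponents in the first variable. *)
have -> : hahn_trunc le g (E c n) = hahn_trunc le g (E d n).
  apply/funext => k; rewrite /hahn_trunc; case: ifP => // gk.
  apply: eq_fsbigr => s /set_mem /= ws; rewrite dc; case: ltP => // alpha_s.
  apply/eqP; apply: contraTT gk => cs.
  rewrite (lt_of_nle G_pow) negbK -ws; apply: (og_trans G_pow) wr.
  apply: (og_trans G_pow) wb.
  have Ks : Krow A s by exact: cK.
  have -> : phi (m b) = (phi \o n) ord0 by rewrite /n /= /p tpermL.
  rewrite -(weight_delta G_pow (phi \o n))//.
  apply: (weight_le G_pow) => //; first exact: Krow_delta.
  move=> i; rewrite !mxE eqxx/=; case: eqP => [->|_]; first by rewrite mulr1.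
  rewrite mulr0; have [C CW Cb] := hat_gseries (GQC_morphism A_GQC) cA.
  by have [Cs _] := Cb s cs i; exact: (CW i).2.
apply: (@truncate_finite l n d g (fset_set (D ord0 `&` [set t | t < alpha]))) => //.
- by apply: IHl => i; exact: sn.
- by move=> v; rewrite in_fset_set// => /set_mem[Dv _]; exact: (Dfin ord0).1.
move=> s ds; rewrite in_fset_set//; apply: mem_set; split; first exact: Dd.
by move: ds; rewrite /= dc; case: ltP => //; rewrite eqxx.
Qed.

End Truncation.

(** * Transasymptotic expansions *)

Section Transasymptotic.
Context {R : realType} (A : fun_class R).
Context (G : groupType) (le : rel G) (pow : G -> R -> G).
Context (M : set (germ R)) (phi : germ R -> G).
Hypothesis S : setting A le pow M phi.
Hypothesis A_hyp : is_an_star A \/ (natural_class A /\ truncation_closed_class A).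

Let G_pow := set_powers S.
Let M_group := set_monomials S.
Local Notation F := (class_germs A M).
Local Notation Phi := (Phi A pow M phi).
Local Notation expands := (expands A pow M phi).

Lemma expands_trunc f H g : expands f H ->
  exists f', expands f' (hahn_trunc le g H).
Proof.
move=> [l [m0 [m [a [Mm0 sm aA _ ->]]]]]; rewrite (hahn_trunc_shift S).
suff [f' f'E] : exists f', expands f'
    (hahn_trunc le ((phi m0)^-1 * g)%g (Ev A pow a (phi \o m))).
  by exists (m0 * f'); exact: (expands_shift S Mm0 f'E).
have [A_an|[A_nat A_trunc]] := A_hyp; first exact: (truncate_an_star S).
exact: (truncate_natural S A_nat A_trunc sm).
Qed.

Lemma Phi_truncation_closed : truncation_closed le F Phi.
Proof.
move=> f g Ff _; have [f' f'E] := expands_trunc g (expands_Phi S Ff).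
by exists f'; rewrite (PhiE S f'E); split=> //; exact: expands_F f'E.
Qed.

(** The leading element of [H] is unique, so [g] must be [phi N] for the monomial of the leading
    term. This is why the elements of the supports come from monomials. *)
Lemma expands_leading f H g : expands f H -> H g != 0 ->
  (forall h, lt_of le g h -> H h = 0) ->
  exists N, [/\ M N, phi N = g & repr f x / repr N x @[x --> +oo] --> H g].
Proof.
move=> fH Hg Hh; have [[_ H0]|/(leading_sim S)] := expands_lead S fH.
  by rewrite H0 eqxx in Hg.
move=> [N [c [MN c0 HN HNh fN]]]; have gN : phi N = g.
  apply/eqP; apply: contraT => Ng; have /orP[le1|le1] := og_total G_pow (phi N) g.
    by rewrite HNh ?eqxx// in Hg; rewrite /lt_of Ng.
  by rewrite -HN Hh ?eqxx// in c0; rewrite /lt_of eq_sym Ng.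
by exists N; split=> //; rewrite -gN HN.
Qed.

Lemma Phi_transasymptotic : transasymptotic le F M Phi.
Proof.
move=> f g Ff fg.
have lead f' : F f' -> Phi f' = hahn_trunc le g (Phi f) -> exists N,
    [/\ M N, phi N = g & repr (f - f') x / repr N x @[x --> +oo] --> Phi f g].
  move=> Ff' f'E; have := expands_sub S Ff Ff'; rewrite f'E => hE.
  have gE : Phi f g - hahn_trunc le g (Phi f) g = Phi f g.
    by rewrite /hahn_trunc /lt_of eqxx subr0.
  have [||N] := expands_leading hE (g := g).
  - by rewrite gE.
  - by move=> h gh; rewrite /hahn_trunc gh subrr.
  by rewrite gE => -[? ? ?]; exists N.
(* The monomial has to be chosen before the truncated germ is given; it is read off from one
   existing truncation, and injectivity of [phi] identifies it with that of any other. *)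
have [f0 f0E] := expands_trunc g (expands_Phi S Ff).
have [N [MN gN _]] := lead f0 (expands_F f0E) (PhiE S f0E).
exists N; split=> //; first by rewrite (PhiE S (expands_monomial S MN)) gN.
move=> f' Ff' f'E; have [N' [MN' gN' cvgN']] := lead f' Ff' f'E.
rewrite (phi_inj S MN MN' (etrans gN (esym gN'))) /germ_sim.
rewrite -(mulfV fg); apply: cvg_trans (cvgM cvgN' (cvg_cst (Phi f g)^-1)).
apply: near_eq_cvg; near=> x.
have cE : repr (germ_cst (Phi f g)) x = Phi f g by near: x; exact: repr_germ_of.
have -> : repr (germ_cst (Phi f g) * N') x = repr (germ_cst (Phi f g)) x * repr N' x.
  by near: x; exact: repr_mul.
rewrite cE.
by rewrite /= invfM mulrAC mulrA.
Unshelve. all: by end_near. Qed.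

End Transasymptotic.
Theorem theorem3p17 (R : realType) (A : fun_class R) (A_GQC : is_GQC A)
    (A_hyp : is_an_star A \/ (natural_class A /\ truncation_closed_class A))
    (G : groupType) (le : rel G) (pow : G -> R -> G)
    (G_pow : ordered_group_with_powers (exponent_field A) le pow)
    (M : set (germ R)) (M_group : monomial_group M)
    (M_pow : forall m r, M m -> exponent_field A r -> M (germ_pow m r))
    (phi : germ R -> G) (phi_emb : ordered_group_embedding le M phi)
    (phi_pow : forall m r, M m -> exponent_field A r ->
       phi (germ_pow m r) = pow (phi m) r) :
  let F := class_germs A M in
  is_ordered_field F /\
  exists Phi : germ R -> G -> R,
    [/\ forall m, M m -> F m /\ Phi m = hahn_mono (phi m),
        ordered_field_embedding le F Phi,
        truncation_closed le F Phi,
        transasymptotic le F M Phi &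
        forall l (m0 : germ R) (m : 'I_l -> germ R) (a : 'rV[R]_l -> R),
          M m0 -> (forall i, M (m i) /\ germ_lt (m i) 1) -> germs A l a ->
          Phi (m0 * germ_comp a m) =
            hahn_mul (hahn_mono (phi m0))
                     (hahn_eval pow (hat A l a) (fun i => phi (m i)))].
Proof.
have S : setting A le pow M phi by [].
split; first exact: (class_germs_field S).
exists (Phi A pow M phi); split.
- move=> m /(expands_monomial S) mE.
  by split; [exact: expands_F mE|exact: (PhiE S mE)].
- exact: (Phi_embedding S).
- exact: (Phi_truncation_closed S A_hyp).
- exact: (Phi_transasymptotic S A_hyp).
move=> l m0 m a Mm0 sm aA; rewrite (PhiE S (expandsI pow phi Mm0 sm aA)).
by apply/funext => g; rewrite hahn_mul_mono.
Qed.
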